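(* Let $y_1\notin\mathbb Zv$ and $y_2\in\mathbb Zv$. Then for $x_2-\frac{uy_2}{v}\in\frac13\mathbb Z$ we have $$\lim_{\varepsilon\to0^+}\varepsilon\sum_{\pm}\pm f_2(z_1,z_2\pm i\varepsilon)=\tfrac1{3\pi}\zeta_1^{-\frac{3y_2}{v}},\qquad \lim_{\varepsilon\to0^+}\varepsilon f_2(z_1,z_2+i\varepsilon)=\tfrac1{6\pi}\zeta_1^{-\frac{3y_2}{v}}.$$ Moreover, for $x_2-\frac{uy_2}{v}\notin\frac13\mathbb Z$ we have $$\lim_{\varepsilon\to0^+}\sum_{\pm}\pm f_2(z_1,z_2\pm i\varepsilon)=0,$$ $$\lim_{\varepsilon\to0^+}f_2(z_1,z_2+i\varepsilon;\tau)=-\frac{i\,\eta^3(3\tau)\,\vartheta(3(z_1+z_2);3\tau)}{\vartheta(3z_1;3\tau)\,\vartheta(3z_2;3\tau)}.$$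
   Context: Notation: $\tau=u+iv\in\mathbb H$ is fixed, $z_j=x_j+iy_j\in\mathbb C$, $q:=e^{2\pi i\tau}$, $\zeta_j:=e^{2\pi i z_j}$. $\sum_\pm\pm g(\pm)$ means $g(+)-g(-)$. $\operatorname{sgn}(x):=x/|x|$ for $x\neq0$, $\operatorname{sgn}(0):=0$; $H(x):=1$ for $x>0$ and $H(x):=0$ for $x\le0$. $\eta(\tau):=q^{1/24}\prod_{n\ge1}(1-q^n)$ and $\vartheta(z;\tau):=\sum_{n\in\frac12+\mathbb Z}q^{n^2/2}e^{2\pi i n(z+\frac12)}$. With $\chi_2(\boldsymbol x):=\operatorname{sgn}(x_1)H(x_1x_2)$, $$f_2(\boldsymbol z;\tau):=\sum_{\boldsymbol n\in\mathbb Z^2}\chi_2\left(\boldsymbol n+\tfrac{\boldsymbol y}{v}\right)q^{3n_1n_2}\zeta_1^{3n_2}\zeta_2^{3n_1}.$$ *)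

(* Defs.v *)
From Stdlib Require Import Reals ZArith List.
From Coquelicot Require Import Coquelicot.

Local Open Scope R_scope.
Local Open Scope C_scope.

Definition Cexp (z : C) : C :=
  (exp (Re z) * cos (Im z), exp (Re z) * sin (Im z))%R.

(* [epow z r] is e^(2 pi i r z).  With q = e^(2 pi i tau) and
   zeta = e^(2 pi i z), it is the reading of q^r (as [epow tau r]) and of
   zeta^r (as [epow z r]), also for the non-integral exponents r that occur in
   theta and eta; for integral r it is the ordinary power. *)
Definition epow (z : C) (r : R) : C :=
  Cexp (RtoC (2 * PI) * Ci * RtoC r * z).

(* Total limit: the limit of [f] along [F] when it exists, and an unspecified
   value otherwise ([iota_filterlim_locally] gives the former). *)
Definition Clim {T : Type} (F : (T -> Prop) -> Prop) (f : T -> C) : C :=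
  @iota C_CompleteNormedModule
    (fun l : C_CompleteNormedModule => filterlim f F (locally l)).

(* The filter of finite subsets of [I] directed by inclusion, a finite subset
   being represented by a duplicate-free list. *)
Definition finite_subsets {I : Type} (P : list I -> Prop) : Prop :=
  exists s0 : list I, forall s : list I, NoDup s -> incl s0 s -> P s.

(* Unordered (equivalently, absolutely convergent) sum of a complex family. *)
Definition Csum {I : Type} (f : I -> C) : C :=
  Clim finite_subsets (fun s => fold_right Cplus 0 (map f s)).

Definition Cprod_from1 (f : nat -> C) : C :=
  Clim eventually (fun N => fold_right Cmult 1 (map f (seq 1 N))).

Definition heaviside (x : R) : R := if Rlt_dec 0 x then 1%R else 0%R.

Definition chi2 (x1 x2 : R) : R := (sign x1 * heaviside (x1 * x2))%R.

Definition f2 (z1 z2 tau : C) : C :=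
  Csum (fun n : Z * Z =>
    let n1 := IZR (fst n) in
    let n2 := IZR (snd n) in
    RtoC (chi2 (n1 + Im z1 / Im tau) (n2 + Im z2 / Im tau))
    * epow tau (3 * n1 * n2) * epow z1 (3 * n2) * epow z2 (3 * n1)).

Definition eta (tau : C) : C :=
  epow tau (1 / 24) * Cprod_from1 (fun n => 1 - epow tau (INR n)).

(* The summation index n in 1/2 + Z is written k + 1/2 with k in Z. *)
Definition theta (z tau : C) : C :=
  Csum (fun k : Z =>
    let n := (IZR k + 1 / 2)%R in
    epow tau (n ^ 2 / 2) * epow (z + RtoC (1 / 2)) n).

(* Main.v *)
Require Import Defs.
From Stdlib Require Import Reals ZArith List Lra Lia Permutation Classical FinFun Bool.
From Stdlib Require Import FunctionalExtensionality.
From Coquelicot Require Import Coquelicot.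

(** Put T = 3 tau, a = 3 z1, b = 3 z2, q = e(T), w = e(a), z = e(b).  Then f2 is the
    Kronecker series sum chi2 q^(n1 n2) w^n2 z^n1, and everything follows from

      sum chi2 q^(n1 n2) w^n2 z^n1 = kappa Theta(w z) / (Theta(w) Theta(z)),

    where Theta(z) = sum_k t_k z^k, t_k = (-1)^k q^(k(k-1)/2), and kappa = (q;q)^3.

    Shifting n2 reduces to |Im b| < Im T.  Then the row n2 = 0 of the left side is the
    geometric series z^N / (1 - z), where N is the least n1 with n1 + Im a / Im T > 0, and
    the other rows converge absolutely for |q| < |z| < 1/|q|.  Since Theta(z) =
    (1 - z) D(z), where the coefficients of D are the partial sums c_k of the t_k, the
    product of Theta(z) with the left side is a convergent Laurent series on this annulus,
    which contains the circle |z| = 1.  The index shift n2 -> n2 + 1 shows that its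
    coefficients satisfy p_(m+1) = - q^m w p_m, so that it equals p_0 Theta(w z).  At z = 1
    this reads D(1) = p_0 Theta(w), which gives the identity with kappa = D(1) as well as
    the nonvanishing of Theta(w) once kappa <> 0.

    Finally kappa = sum_k c_k = - sum_k k t_k, and this is (q;q)^3 by Jacobi: it is the
    limit of the derivative at z = 1 of the finite triple product, whose coefficients obey
    an explicit three-term recursion. *)

Local Open Scope R_scope.
Local Open Scope C_scope.

(** * Limits of complex functions *)

(** For [y2] in [Z v] the two vertical approaches meet different series: in the row where
    [n2 + y2/v] vanishes in the limit, one side sums [z^n1] over [n1 >= N], the other sums [- z^n1]
    over [n1 < N], and neither half-series converges on [|z| = 1]. Both represent the same rational
    function of [z], so one meromorphic quotient describes both sides, and the limits depend only on
    whether the point approached is its pole [z = 1]. Multiplication by Theta removes this pole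
    because Theta(1) = 0. The same vanishing makes the partial sums [c_k] small at both ends, so the
    product identity remains valid at [z = 1] and can be used there to fix the normalization. At the
    pole the quotient behaves like [1 / (1 - z)], with coefficient kappa Theta(w) / (Theta(w) D(1))
    = 1. Since [b = 3 z2], a displacement by [eps] gives [1 - z] of size [6 pi eps], which is the
    constant of the theorem; [z1] survives only in the factor [e(-m a)] of the row shift. *)

Definition tends_to {T : Type} (F : (T -> Prop) -> Prop) (f : T -> C) (l : C) :=
  forall eps : R, (0 < eps)%R -> F (fun x => (Cmod (f x - l) < eps)%R).

(** The balls behind [locally] are boxes in the two coordinates. A box of half-side [d] only lies in
    the disc of radius [sqrt 2 * d], whence the rescaled radius in the converse. *)
Lemma tends_to_filterlim {T : Type} (F : (T -> Prop) -> Prop) {FF : Filter F}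
  (f : T -> C) (l : C) : tends_to F f l <-> filterlim f F (locally l).
Proof.
  split.
  - intros H P [eps HP]. unfold filtermap.
    apply (filter_imp (fun x => (Cmod (f x - l) < eps)%R)).
    + intros x Hx. apply HP. now apply C_NormedModule_mixin_compat1.
    + apply H, cond_pos.
  - intros H eps Heps.
    assert (H2 : (0 < sqrt 2)%R) by (apply sqrt_lt_R0; lra).
    assert (He : (0 < eps / sqrt 2)%R) by now apply Rdiv_lt_0_compat.
    apply (H (fun y => (Cmod (y - l) < eps)%R)).
    exists (mkposreal _ He). intros y Hy.
    apply C_NormedModule_mixin_compat2 in Hy. simpl in Hy.
    replace (sqrt 2 * (eps / sqrt 2))%R with eps in Hy by (field; lra).
    exact Hy.
Qed.

Lemma tends_to_ext {T : Type} (F : (T -> Prop) -> Prop) {FF : Filter F}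
  (f g : T -> C) (l : C) :
  F (fun x => f x = g x) -> tends_to F f l -> tends_to F g l.
Proof.
  intros H1 H2 eps He.
  generalize (filter_and _ _ H1 (H2 eps He)).
  apply filter_imp. intros x [<- Hx]. exact Hx.
Qed.

Lemma tends_to_const {T : Type} (F : (T -> Prop) -> Prop) {FF : Filter F} (c : C) :
  tends_to F (fun _ => c) c.
Proof.
  intros eps He. apply filter_forall. intros _.
  replace (c - c) with (RtoC 0) by ring. now rewrite Cmod_0.
Qed.

Lemma tends_to_plus {T : Type} (F : (T -> Prop) -> Prop) {FF : Filter F}
  (f g : T -> C) (a b : C) :
  tends_to F f a -> tends_to F g b -> tends_to F (fun x => f x + g x) (a + b).
Proof.
  intros Hf Hg eps He.
  assert (He2 : (0 < eps / 2)%R) by lra.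
  generalize (filter_and _ _ (Hf _ He2) (Hg _ He2)).
  apply filter_imp. intros x [H1 H2].
  replace (f x + g x - (a + b)) with ((f x - a) + (g x - b)) by ring.
  eapply Rle_lt_trans; [apply Cmod_triangle | lra].
Qed.

Lemma tends_to_mult {T : Type} (F : (T -> Prop) -> Prop) {FF : Filter F}
  (f g : T -> C) (a b : C) :
  tends_to F f a -> tends_to F g b -> tends_to F (fun x => f x * g x) (a * b).
Proof.
  intros Hf Hg eps He.
  pose proof (Cmod_ge_0 a) as Ha. pose proof (Cmod_ge_0 b) as Hb.
  set (M := (Cmod a + Cmod b + 1)%R).
  assert (HM : (1 <= M)%R) by (unfold M; lra).
  (* The cap at 1 makes the product of the two errors at most [d], so the three error terms add up
     to at most [d * M], half of [eps]. *)
  set (d := Rmin 1 (eps / (2 * M))).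
  assert (Hd : (0 < d)%R).
  { apply Rmin_pos; [lra | apply Rdiv_lt_0_compat; lra]. }
  generalize (filter_and _ _ (Hf _ Hd) (Hg _ Hd)).
  apply filter_imp. intros x [H1 H2].
  replace (f x * g x - a * b)
    with ((f x - a) * (g x - b) + ((f x - a) * b + a * (g x - b))) by ring.
  eapply Rle_lt_trans; [apply Cmod_triangle |].
  eapply Rle_lt_trans; [apply Rplus_le_compat_l, Cmod_triangle |].
  rewrite !Cmod_mult.
  pose proof (Cmod_ge_0 (f x - a)) as P1. pose proof (Cmod_ge_0 (g x - b)) as P2.
  assert (D1 : (d <= 1)%R) by apply Rmin_l.
  assert (D2 : (d * (2 * M) <= eps)%R).
  { replace eps with (eps / (2 * M) * (2 * M))%R by (field; lra).
    apply Rmult_le_compat_r; [lra | apply Rmin_r]. }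
  assert (Cmod (f x - a) * Cmod (g x - b) <= d * 1)%R
    by (apply Rmult_le_compat; lra).
  assert (Cmod (f x - a) * Cmod b <= d * Cmod b)%R
    by (apply Rmult_le_compat_r; lra).
  assert (Cmod a * Cmod (g x - b) <= d * Cmod a)%R
    by (rewrite (Rmult_comm d); apply Rmult_le_compat_l; lra).
  unfold M in D2. nra.
Qed.

Lemma tends_to_inv {T : Type} (F : (T -> Prop) -> Prop) {FF : Filter F}
  (f : T -> C) (a : C) :
  a <> 0 -> tends_to F f a -> tends_to F (fun x => / f x) (/ a).
Proof.
  intros Ha Hf eps He.
  assert (A : (0 < Cmod a)%R) by now apply Cmod_gt_0.
  set (d := Rmin (Cmod a / 2) (eps * (Cmod a * Cmod a) / 2)).
  assert (Hd : (0 < d)%R).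
  { apply Rmin_pos; [lra |].
    apply Rdiv_lt_0_compat; [|lra]. repeat apply Rmult_lt_0_compat; lra. }
  generalize (Hf _ Hd). apply filter_imp. intros x Hx.
  assert (D1 : (d <= Cmod a / 2)%R) by apply Rmin_l.
  assert (D2 : (d <= eps * (Cmod a * Cmod a) / 2)%R) by apply Rmin_r.
  assert (L : (Cmod a / 2 < Cmod (f x))%R).
  { assert (Cmod a <= Cmod (f x) + Cmod (f x - a))%R.
    { replace a with (f x + - (f x - a)) at 1 by ring.
      rewrite <- (Cmod_opp (f x - a)). apply Cmod_triangle. }
    lra. }
  assert (Hx0 : f x <> 0) by (apply Cmod_gt_0; lra).
  replace (/ f x - / a) with (- (f x - a) * (/ f x * / a)) by (field; auto).
  rewrite !Cmod_mult, Cmod_opp, !Cmod_inv by auto.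
  apply (Rmult_lt_reg_r (Cmod (f x) * Cmod a)); [apply Rmult_lt_0_compat; lra |].
  replace (Cmod (f x - a) * (/ Cmod (f x) * / Cmod a) * (Cmod (f x) * Cmod a))%R
    with (Cmod (f x - a)) by (field; lra).
  eapply Rlt_le_trans; [exact Hx |]. eapply Rle_trans; [exact D2 |].
  replace (eps * (Cmod a * Cmod a) / 2)%R with (eps * (Cmod a / 2 * Cmod a))%R by field.
  apply Rmult_le_compat_l; [lra |]. apply Rmult_le_compat_r; lra.
Qed.

Lemma tends_to_unique {T : Type} (F : (T -> Prop) -> Prop) {FF : ProperFilter F}
  (f : T -> C) (a b : C) : tends_to F f a -> tends_to F f b -> a = b.
Proof.
  intros Ha Hb. destruct (classic (a = b)) as [|N]; [assumption | exfalso].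
  assert (P : (0 < Cmod (a - b))%R).
  { apply Cmod_gt_0. now apply Cminus_eq_contra. }
  assert (P2 : (0 < Cmod (a - b) / 2)%R) by lra.
  destruct (filter_ex _ (filter_and _ _ (Ha _ P2) (Hb _ P2))) as [x [H1 H2]].
  assert (Cmod (a - b) <= Cmod (f x - b) + Cmod (f x - a))%R; [|lra].
  replace (a - b) with ((f x - b) + - (f x - a)) by ring.
  rewrite <- (Cmod_opp (f x - a)). apply Cmod_triangle.
Qed.

Lemma tends_to_Cmod_le {T : Type} (F : (T -> Prop) -> Prop) {FF : ProperFilter F}
  (f : T -> C) (a b : C) (M : R) :
  tends_to F f a -> F (fun x => (Cmod (f x - b) <= M)%R) -> (Cmod (a - b) <= M)%R.
Proof.
  intros Hf HM. apply le_epsilon. intros eps He.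
  destruct (filter_ex _ (filter_and _ _ (Hf _ He) HM)) as [x [H1 H2]].
  replace (a - b) with ((f x - b) + - (f x - a)) by ring.
  eapply Rle_trans; [apply Cmod_triangle |]. rewrite Cmod_opp. lra.
Qed.

(** * Finite sums *)

Definition csum {I : Type} (f : I -> C) (s : list I) : C :=
  fold_right Cplus 0 (map f s).

Definition rsum {I : Type} (g : I -> R) (s : list I) : R :=
  fold_right Rplus 0%R (map g s).

Lemma csum_app {I : Type} (f : I -> C) (s t : list I) :
  csum f (s ++ t) = csum f s + csum f t.
Proof.
  induction s as [|x s IH]; unfold csum in *; simpl; [ring | rewrite IH; ring].
Qed.

Lemma rsum_app {I : Type} (g : I -> R) (s t : list I) :
  rsum g (s ++ t) = (rsum g s + rsum g t)%R.
Proof.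
  induction s as [|x s IH]; unfold rsum in *; simpl; [ring | rewrite IH; ring].
Qed.

Lemma csum_map {I J : Type} (f : J -> C) (h : I -> J) (s : list I) :
  csum f (map h s) = csum (fun i => f (h i)) s.
Proof. unfold csum. now rewrite map_map. Qed.

Lemma rsum_map {I J : Type} (g : J -> R) (h : I -> J) (s : list I) :
  rsum g (map h s) = rsum (fun i => g (h i)) s.
Proof. unfold rsum. now rewrite map_map. Qed.

Lemma csum_perm {I : Type} (f : I -> C) (s t : list I) :
  Permutation s t -> csum f s = csum f t.
Proof.
  unfold csum. induction 1; simpl; auto; [now rewrite IHPermutation | ring | congruence].
Qed.

Lemma rsum_perm {I : Type} (f : I -> R) (s t : list I) :
  Permutation s t -> rsum f s = rsum f t.
Proof.
  unfold rsum. induction 1; simpl; auto; [now rewrite IHPermutation | ring | congruence].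
Qed.

Lemma csum_plus {I : Type} (f g : I -> C) (s : list I) :
  csum (fun i => f i + g i) s = csum f s + csum g s.
Proof.
  induction s as [|x s IH]; unfold csum in *; simpl; [ring | rewrite IH; ring].
Qed.

Lemma csum_scal {I : Type} (c : C) (f : I -> C) (s : list I) :
  csum (fun i => c * f i) s = c * csum f s.
Proof.
  induction s as [|x s IH]; unfold csum in *; simpl; [ring | rewrite IH; ring].
Qed.

Lemma rsum_scal {I : Type} (c : R) (f : I -> R) (s : list I) :
  rsum (fun i => c * f i)%R s = (c * rsum f s)%R.
Proof.
  induction s as [|x s IH]; unfold rsum in *; simpl; [ring | rewrite IH; ring].
Qed.

Lemma rsum_le {I : Type} (f g : I -> R) (s : list I) :
  (forall i, (f i <= g i)%R) -> (rsum f s <= rsum g s)%R.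
Proof.
  intros H. induction s as [|x s IH]; unfold rsum in *; simpl; [lra |].
  specialize (H x). lra.
Qed.

Lemma rsum_ge_0 {I : Type} (g : I -> R) (s : list I) :
  (forall i, (0 <= g i)%R) -> (0 <= rsum g s)%R.
Proof.
  intros H. induction s as [|x s IH]; unfold rsum in *; simpl; [lra |].
  specialize (H x). lra.
Qed.

Lemma Cmod_csum_le {I : Type} (f : I -> C) (s : list I) :
  (Cmod (csum f s) <= rsum (fun i => Cmod (f i)) s)%R.
Proof.
  induction s as [|x s IH]; unfold csum, rsum in *; simpl.
  - rewrite Cmod_0. lra.
  - eapply Rle_trans; [apply Cmod_triangle | lra].
Qed.

Lemma rsum_incl {I : Type} (g : I -> R) (s t : list I) :
  (forall i, (0 <= g i)%R) -> NoDup s -> incl s t -> (rsum g s <= rsum g t)%R.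
Proof.
  intros Hg Hs. revert t. induction Hs as [|x s Hx Hs IH]; intros t Ht.
  - now apply rsum_ge_0.
  - destruct (in_split x t) as (t1 & t2 & ->); [apply Ht; now left |].
    rewrite (rsum_perm g (t1 ++ x :: t2) (x :: t1 ++ t2))
      by (apply Permutation_sym, Permutation_middle).
    unfold rsum at 1 2; simpl. apply Rplus_le_compat_l. apply IH.
    intros y Hy. assert (Hy' : In y (t1 ++ x :: t2)) by (apply Ht; now right).
    apply in_or_app. apply in_app_or in Hy'. destruct Hy' as [|[<-|]]; auto; contradiction.
Qed.

Lemma exists_nodup {I : Type} (s : list I) :
  exists t, NoDup t /\ forall x, In x t <-> In x s.
Proof.
  induction s as [|x s (t & Ht & E)].
  - exists nil. split; [constructor | tauto].
  - destruct (classic (In x t)) as [H|H].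
    + exists t. split; auto. intros y. simpl. rewrite <- E.
      split; [auto | intros [<-|]; auto].
    + exists (x :: t). split; [now constructor |]. intros y; simpl. now rewrite E.
Qed.

Lemma nodup_incl_split {I : Type} (s t : list I) :
  NoDup s -> NoDup t -> incl s t ->
  exists r, NoDup r /\ Permutation t (s ++ r) /\ forall x, In x r -> ~ In x s.
Proof.
  intros Hs. revert t. induction Hs as [|x s Hx Hs IH]; intros t Ht Hst.
  - exists t. repeat split; auto.
  - destruct (in_split x t) as (t1 & t2 & ->); [apply Hst; now left |].
    destruct (IH (t1 ++ t2)) as (r & Hr & P & D).
    + now apply NoDup_remove_1 in Ht.
    + intros y Hy. assert (Hy' : In y (t1 ++ x :: t2)) by (apply Hst; now right).
      apply in_or_app. apply in_app_or in Hy'.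
      destruct Hy' as [|[<-|]]; auto; contradiction.
    + exists r. repeat split; auto.
      * rewrite <- Permutation_middle, P. reflexivity.
      * intros y Hy [<-|Hys]; [|now apply (D y)].
        apply NoDup_remove_2 in Ht. apply Ht.
        apply (Permutation_in _ (Permutation_sym P)). apply in_or_app; auto.
Qed.

(** * Unordered sums *)

#[global] Instance finite_subsets_filter {I : Type} :
  ProperFilter (@finite_subsets I).
Proof.
  split; [|split].
  - intros P [s0 H]. destruct (exists_nodup s0) as (t & Ht & E).
    exists t. apply H; auto. intros x; apply E.
  - exists nil. auto.
  - intros P Q [s H] [t G]. exists (s ++ t). intros u Hu Hi.
    split; [apply H | apply G]; auto; intros x Hx; apply Hi, in_or_app; auto.
  - intros P Q H [s G]. exists s. auto.
Qed.

(** [Csum] is an unspecified value unless the finite sums converge. This relation carries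
    convergence and value together, so identities are proved for it and only then moved to
    [Csum]. *)
Definition has_sum {I : Type} (f : I -> C) (l : C) : Prop :=
  tends_to finite_subsets (csum f) l.

Lemma Csum_eq {I : Type} (f : I -> C) (l : C) : has_sum f l -> Csum f = l.
Proof.
  intros H. unfold Csum, Clim.
  apply (@iota_filterlim_locally C_AbsRing C_CompleteNormedModule).
  - apply Proper_StrongProper, finite_subsets_filter.
  - apply (tends_to_filterlim finite_subsets), H.
Qed.

Lemma has_sum_unique {I : Type} (f : I -> C) (a b : C) :
  has_sum f a -> has_sum f b -> a = b.
Proof. apply tends_to_unique, finite_subsets_filter. Qed.

Lemma has_sum_ext {I : Type} (f g : I -> C) (l : C) :
  (forall i, f i = g i) -> has_sum f l -> has_sum g l.
Proof.
  intros H. apply tends_to_ext; [apply finite_subsets_filter |].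
  apply filter_forall. intros s. unfold csum. f_equal. now apply map_ext.
Qed.

Lemma has_sum_plus {I : Type} (f g : I -> C) (a b : C) :
  has_sum f a -> has_sum g b -> has_sum (fun i => f i + g i) (a + b).
Proof.
  intros Hf Hg. unfold has_sum.
  eapply tends_to_ext; [| |exact (tends_to_plus finite_subsets _ _ _ _ Hf Hg)];
    [apply finite_subsets_filter |].
  apply filter_forall. intros s. now rewrite csum_plus.
Qed.

Lemma has_sum_scal {I : Type} (c : C) (f : I -> C) (a : C) :
  has_sum f a -> has_sum (fun i => c * f i) (c * a).
Proof.
  intros Hf. unfold has_sum.
  eapply tends_to_ext;
    [| |exact (tends_to_mult finite_subsets _ _ _ _ (tends_to_const finite_subsets c) Hf)];
    [apply finite_subsets_filter |].
  apply filter_forall. intros s. now rewrite csum_scal.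
Qed.

Lemma preimage_list {I J : Type} (phi : I -> J) (f : J -> C) (s : list J) :
  (forall i i', phi i = phi i' -> i = i') ->
  (forall j, (forall i, phi i <> j) -> f j = 0) -> NoDup s ->
  exists t, NoDup t /\ (forall i, In i t <-> In (phi i) s) /\
            csum f s = csum (fun i => f (phi i)) t.
Proof.
  intros Hinj H0. induction 1 as [|j s Hj Hs (t & Ht & E & S)].
  - exists nil. repeat split; simpl; auto; constructor.
  - destruct (classic (exists i, phi i = j)) as [[i <-]|N].
    + exists (i :: t). repeat split.
      * constructor; auto. now rewrite E.
      * simpl. intros [<-|]; [auto | right; now apply E].
      * simpl. intros [Hi|]; [left; now apply Hinj | right; now apply E].
      * unfold csum in *. simpl. now rewrite S.
    + exists t. repeat split; auto.
      * simpl. rewrite E. auto.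
      * simpl. rewrite E. intros [Hi|]; auto. exfalso; eauto.
      * rewrite <- S. unfold csum. simpl. rewrite H0; [ring | eauto].
Qed.

(** Indices outside the image contribute zero, so a finite sum over [J] is a finite sum over its
    preimage. This serves for reindexing by bijections and for placing a one-dimensional sum as a
    row of the lattice. *)
Lemma has_sum_inj {I J : Type} (phi : I -> J) (f : J -> C) (l : C) :
  (forall i i', phi i = phi i' -> i = i') ->
  (forall j, (forall i, phi i <> j) -> f j = 0) ->
  has_sum (fun i => f (phi i)) l -> has_sum f l.
Proof.
  intros Hinj H0 H eps He. destruct (H eps He) as [s0 Hs0].
  exists (map phi s0). intros s Hs Hi.
  destruct (preimage_list phi f s Hinj H0 Hs) as (t & Ht & E & ->).
  apply Hs0; auto. intros i Hin. apply E, Hi, in_map, Hin.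
Qed.

Lemma has_sum_bij {I J : Type} (phi : I -> J) (psi : J -> I) (f : J -> C) (l : C) :
  (forall i, psi (phi i) = i) -> (forall j, phi (psi j) = j) ->
  has_sum f l -> has_sum (fun i => f (phi i)) l.
Proof.
  intros H1 H2 H. apply (has_sum_inj psi).
  - intros i i' E. rewrite <- (H2 i), E. apply H2.
  - intros i N. destruct (N (phi i)). apply H1.
  - revert H. apply has_sum_ext. intros j. now rewrite H2.
Qed.

Lemma has_sum_shift (f : Z -> C) (k : Z) (l : C) :
  has_sum f l -> has_sum (fun n => f (n + k)%Z) l.
Proof.
  apply (has_sum_bij (fun n => (n + k)%Z) (fun n => (n - k)%Z)); intros; ring.
Qed.

Lemma has_sum_single {I : Type} (i0 : I) (f : I -> C) (v : C) :
  f i0 = v -> (forall i, i <> i0 -> f i = 0) -> has_sum f v.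
Proof.
  intros <- H. apply (has_sum_inj (fun _ : unit => i0)).
  - now intros [] [].
  - intros j N. apply H. intros ->. now apply (N tt).
  - intros eps He. exists (tt :: nil). intros s Hs Hi.
    destruct s as [|[] [|[] s]].
    + now destruct (Hi tt (or_introl eq_refl)).
    + unfold csum; simpl. replace (f i0 + 0 - f i0) with (RtoC 0) by ring. now rewrite Cmod_0.
    + inversion Hs as [|? ? N]. exfalso. apply N. now left.
Qed.

(** * Absolute summability, dominated convergence and iterated sums *)

Definition summable {I : Type} (g : I -> R) : Prop :=
  exists B : R, forall s, NoDup s -> (rsum g s <= B)%R.

Lemma summable_le {I : Type} (f g : I -> R) :
  (forall i, (f i <= g i)%R) -> summable g -> summable f.
Proof.
  intros H [B HB]. exists B. intros s Hs.
  eapply Rle_trans; [now apply rsum_le | auto].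
Qed.

Lemma summable_scal {I : Type} (c : R) (g : I -> R) :
  (0 <= c)%R -> summable g -> summable (fun i => c * g i)%R.
Proof.
  intros Hc [B HB]. exists (c * B)%R. intros s Hs.
  rewrite rsum_scal. apply Rmult_le_compat_l; auto.
Qed.

Lemma summable_inj {I J : Type} (phi : I -> J) (g : J -> R) :
  (forall i i', phi i = phi i' -> i = i') ->
  summable g -> summable (fun i => g (phi i)).
Proof.
  intros Hinj [B HB]. exists B. intros s Hs. rewrite <- rsum_map.
  apply HB. now apply Injective_map_NoDup.
Qed.

Lemma rsum_list_prod {I J : Type} (f : I -> R) (g : J -> R) (s : list I) (t : list J) :
  rsum (fun p : I * J => f (fst p) * g (snd p))%R (list_prod s t) = (rsum f s * rsum g t)%R.
Proof.
  induction s as [|x s IH]; simpl.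
  - unfold rsum; simpl; ring.
  - rewrite rsum_app, IH, rsum_map. simpl.
    rewrite (rsum_scal (f x) g t). unfold rsum; simpl; ring.
Qed.

Lemma summable_prod {I J : Type} (f : I -> R) (g : J -> R) :
  (forall i, (0 <= f i)%R) -> (forall j, (0 <= g j)%R) ->
  summable f -> summable g ->
  summable (fun p : I * J => f (fst p) * g (snd p))%R.
Proof.
  intros Pf Pg [B HB] [B' HB']. exists (B * B')%R. intros s Hs.
  destruct (exists_nodup (map fst s)) as (s1 & N1 & E1).
  destruct (exists_nodup (map snd s)) as (s2 & N2 & E2).
  apply Rle_trans with
    (rsum (fun p : I * J => f (fst p) * g (snd p))%R (list_prod s1 s2)).
  - apply rsum_incl; auto.
    + intros; now apply Rmult_le_pos.
    + intros [x y] Hp. apply in_prod_iff. rewrite E1, E2.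
      split; [now apply (in_map fst) in Hp | now apply (in_map snd) in Hp].
  - rewrite rsum_list_prod.
    apply Rmult_le_compat; auto using rsum_ge_0.
Qed.

(** Take [s0] whose sum is within [eps] of the supremum [m] of all finite sums: a disjoint [r] can
    be appended to [s0] without exceeding [m]. *)
Lemma summable_tail {I : Type} (g : I -> R) :
  (forall i, (0 <= g i)%R) -> summable g ->
  forall eps, (0 < eps)%R -> exists s0, NoDup s0 /\
    forall r, NoDup r -> (forall x, In x r -> ~ In x s0) -> (rsum g r <= eps)%R.
Proof.
  intros Pg [B HB] eps He.
  destruct (completeness (fun x => exists s, NoDup s /\ x = rsum g s)) as [m [U L]].
  - exists B. intros x (s & Hs & ->). auto.
  - exists (rsum g nil), nil. split; [constructor | auto].
  - destruct (classic (exists s0, NoDup s0 /\ (m - eps < rsum g s0)%R))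
      as [(s0 & N0 & H0)|N].
    + exists s0. split; auto. intros r Hr D.
      assert (rsum g (s0 ++ r) <= m)%R.
      { apply U. exists (s0 ++ r). split; auto.
        apply NoDup_app; auto. firstorder. }
      rewrite rsum_app in H. lra.
    + exfalso. assert (m <= m - eps)%R; [|lra].
      apply L. intros x (s & Hs & ->). apply Rnot_lt_le. intros C. apply N. eauto.
Qed.

Lemma csum_tail {I : Type} (f : I -> C) (g : I -> R) (s0 s : list I) (eps : R) :
  (forall i, (Cmod (f i) <= g i)%R) ->
  (forall r, NoDup r -> (forall x, In x r -> ~ In x s0) -> (rsum g r <= eps)%R) ->
  NoDup s0 -> NoDup s -> incl s0 s -> (Cmod (csum f s - csum f s0) <= eps)%R.
Proof.
  intros Hf H N0 N Hi.
  destruct (nodup_incl_split s0 s N0 N Hi) as (r & Nr & P & D).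
  rewrite (csum_perm _ _ _ P), csum_app.
  replace (csum f s0 + csum f r - csum f s0) with (csum f r) by ring.
  eapply Rle_trans; [apply Cmod_csum_le |].
  eapply Rle_trans; [now apply rsum_le | auto].
Qed.

Lemma summable_has_sum {I : Type} (f : I -> C) :
  summable (fun i => Cmod (f i)) -> has_sum f (Csum f).
Proof.
  intros H.
  assert (E : exists l, has_sum f l).
  { destruct (filterlim_locally_cauchy (F := finite_subsets)
      (U := C_CompleteNormedModule) (csum f)) as [K _].
    destruct K as [l Hl].
    - intros eps.
      assert (He : (0 < eps / 3)%R) by (pose proof (cond_pos eps); lra).
      destruct (summable_tail _ (fun i => Cmod_ge_0 (f i)) H _ He) as (s0 & N0 & H0).
      exists (fun s => NoDup s /\ incl s0 s). split; [exists s0; auto |].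
      intros u v [Nu Iu] [Nv Iv]. apply C_NormedModule_mixin_compat1.
      change (Cmod (csum f v - csum f u) < eps)%R.
      replace (csum f v - csum f u)
        with ((csum f v - csum f s0) + - (csum f u - csum f s0)) by ring.
      eapply Rle_lt_trans; [apply Cmod_triangle |]. rewrite Cmod_opp.
      pose proof (csum_tail f _ s0 u _ (fun i => Rle_refl _) H0 N0 Nu Iu).
      pose proof (csum_tail f _ s0 v _ (fun i => Rle_refl _) H0 N0 Nv Iv).
      pose proof (cond_pos eps). lra.
    - exists l. apply tends_to_filterlim; [apply finite_subsets_filter | exact Hl]. }
  destruct E as [l Hl]. now rewrite (Csum_eq f l Hl).
Qed.

Lemma has_sum_tail {I : Type} (f : I -> C) (l : C) (g : I -> R) (s0 : list I) (eps : R) :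
  (forall i, (Cmod (f i) <= g i)%R) ->
  (forall r, NoDup r -> (forall x, In x r -> ~ In x s0) -> (rsum g r <= eps)%R) ->
  NoDup s0 -> has_sum f l -> (Cmod (l - csum f s0) <= eps)%R.
Proof.
  intros Hf H N0 Hl.
  apply (tends_to_Cmod_le finite_subsets (csum f)); auto.
  exists s0. intros s N Hi. now apply (csum_tail f g).
Qed.

Lemma tends_to_csum {I T : Type} (F : (T -> Prop) -> Prop) {FF : Filter F}
  (f : T -> I -> C) (l : I -> C) (s : list I) :
  (forall i, tends_to F (fun x => f x i) (l i)) ->
  tends_to F (fun x => csum (f x) s) (csum l s).
Proof.
  intros H. induction s as [|i s IH].
  - exact (tends_to_const F (RtoC 0)).
  - apply (tends_to_plus F (fun x => f x i) (fun x => csum (f x) s)); auto.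
Qed.

(** Outside one finite set [s0] the majorant bounds both tails by [eps / 3], uniformly along the
    filter; on [s0] termwise convergence suffices. *)
Lemma dominated_convergence {I T : Type} (F : (T -> Prop) -> Prop) {FF : Filter F}
  (f : T -> I -> C) (l : I -> C) (S : T -> C) (L : C) (g : I -> R) :
  summable g ->
  F (fun x => forall i, (Cmod (f x i) <= g i)%R) ->
  (forall i, (Cmod (l i) <= g i)%R) ->
  (forall i, tends_to F (fun x => f x i) (l i)) ->
  F (fun x => has_sum (f x) (S x)) -> has_sum l L ->
  tends_to F S L.
Proof.
  intros Hg Hf Hl Hlim HS HL eps He.
  assert (He3 : (0 < eps / 3)%R) by lra.
  destruct (summable_tail g) with (eps := (eps / 3)%R) as (s0 & N0 & H0); auto.
  { intros i. eapply Rle_trans; [apply Cmod_ge_0 | apply (Hl i)]. }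
  pose proof (has_sum_tail l L g s0 _ Hl H0 N0 HL) as A.
  generalize (filter_and _ _ (filter_and _ _ Hf HS)
    (tends_to_csum F f l s0 Hlim _ He3)).
  apply filter_imp. intros x [[Hx Sx] Cx].
  pose proof (has_sum_tail _ _ g s0 _ Hx H0 N0 Sx) as B.
  replace (S x - L) with ((S x - csum (f x) s0) +
    ((csum (f x) s0 - csum l s0) + - (L - csum l s0))) by ring.
  eapply Rle_lt_trans; [apply Cmod_triangle |].
  eapply Rle_lt_trans; [apply Rplus_le_compat_l, Cmod_triangle |].
  rewrite Cmod_opp. lra.
Qed.

Lemma csum_list_prod {I J : Type} (f : I * J -> C) (s : list I) (t : list J) :
  csum f (list_prod s t) = csum (fun i => csum (fun j => f (i, j)) t) s.
Proof.
  induction s as [|x s IH]; simpl; [reflexivity |].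
  rewrite csum_app, IH, csum_map. reflexivity.
Qed.

Lemma nodup_list_prod {I J : Type} (s : list I) (t : list J) :
  NoDup s -> NoDup t -> NoDup (list_prod s t).
Proof.
  intros Hs Ht. induction Hs as [|x s Hx Hs IH]; simpl; [constructor |].
  apply NoDup_app; auto.
  - apply Injective_map_NoDup; auto. intros a b E. now injection E.
  - intros p Hp Hq. apply in_map_iff in Hp. destruct Hp as (y & <- & _).
    apply in_prod_iff in Hq. tauto.
Qed.

Lemma has_sum_fubini {I J : Type} (f : I * J -> C) (G : I -> C) :
  summable (fun p => Cmod (f p)) ->
  (forall i, has_sum (fun j => f (i, j)) (G i)) -> has_sum G (Csum f).
Proof.
  intros Hf HG eps He.
  assert (He2 : (0 < eps / 3)%R) by lra.
  destruct (summable_tail _ (fun p => Cmod_ge_0 (f p)) Hf _ He2) as (s0 & N0 & H0).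
  pose proof (has_sum_tail f _ _ s0 _ (fun p => Rle_refl _) H0 N0
    (summable_has_sum f Hf)) as A.
  exists (map fst s0). intros s Ns Is.
  (* Each row sum is a limit over [t], so [csum G s] is a limit of sums over boxes [s x t]. Once the
     box contains [s0], its sum is within [eps / 3] of [csum f s0], and the bound passes to the
     limit. *)
  assert (B : (Cmod (csum G s - csum f s0) <= eps / 3)%R).
  { apply (tends_to_Cmod_le finite_subsets
      (fun t => csum (fun i => csum (fun j => f (i, j)) t) s)).
    - apply tends_to_csum; [apply finite_subsets_filter | exact HG].
    - exists (map snd s0). intros t Nt It. rewrite <- csum_list_prod.
      apply (csum_tail f _ s0 _ _ (fun p => Rle_refl _) H0 N0).
      + now apply nodup_list_prod.
      + intros [x y] Hp. apply in_prod_iff. split.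
        * apply Is. now apply (in_map fst) in Hp.
        * apply It. now apply (in_map snd) in Hp. }
  replace (csum G s - Csum f) with ((csum G s - csum f s0) + - (Csum f - csum f s0)) by ring.
  eapply Rle_lt_trans; [apply Cmod_triangle |]. rewrite Cmod_opp. lra.
Qed.

Lemma has_sum_prod {I J : Type} (f : I -> C) (g : J -> C) (a b : C) :
  summable (fun i => Cmod (f i)) -> summable (fun j => Cmod (g j)) ->
  has_sum f a -> has_sum g b ->
  has_sum (fun p : I * J => f (fst p) * g (snd p)) (a * b).
Proof.
  intros Sf Sg Hf Hg.
  assert (S : summable (fun p : I * J => Cmod (f (fst p) * g (snd p)))).
  { eapply summable_le; [|apply (summable_prod _ _ (fun i => Cmod_ge_0 (f i))
      (fun j => Cmod_ge_0 (g j)) Sf Sg)].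
    intros p. rewrite Cmod_mult. apply Rle_refl. }
  replace (a * b) with (Csum (fun p : I * J => f (fst p) * g (snd p))).
  - now apply summable_has_sum.
  - apply (has_sum_unique (fun i => b * f i)).
    + apply (has_sum_fubini (fun p : I * J => f (fst p) * g (snd p))); auto.
      intros i. simpl.
      rewrite (Cmult_comm b). now apply has_sum_scal.
    + rewrite (Cmult_comm a). now apply has_sum_scal.
Qed.

(** * Geometric and exponential majorants *)

Lemma exp_pow (x : R) (n : nat) : exp (INR n * x) = (exp x ^ n)%R.
Proof.
  induction n as [|n IH]; [simpl; rewrite Rmult_0_l; apply exp_0 |].
  rewrite S_INR, Rmult_plus_distr_r, exp_plus, IH, Rmult_1_l. simpl. ring.
Qed.

Lemma geometric_bound (x : R) (n : nat) :
  (0 < x < 1)%R -> (rsum (fun k => x ^ k) (seq 0 n) <= / (1 - x))%R.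
Proof.
  intros Hx.
  assert (E : rsum (fun k => (x ^ k)%R) (seq 0 n) = ((1 - x ^ n) * / (1 - x))%R).
  { induction n as [|n IH].
    - unfold rsum; simpl. field. lra.
    - rewrite seq_S, rsum_app, IH. unfold rsum; simpl. field. lra. }
  rewrite E. assert (0 <= x ^ n)%R by (apply pow_le; lra).
  assert (0 < / (1 - x))%R by (apply Rinv_0_lt_compat; lra). nra.
Qed.

Lemma summable_exp (r : R) : (0 < r)%R ->
  summable (fun n : Z => exp (- (r * Rabs (IZR n)))).
Proof.
  intros Hr. set (x := exp (- r)).
  assert (Hx : (0 < x < 1)%R).
  { split; [apply exp_pos |]. rewrite <- exp_0. apply exp_increasing; lra. }
  exists (/ (1 - x) + / (1 - x))%R. intros s Hs.
  (* The covering list counts 0 twice, which is harmless for an upper bound with nonnegative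
     terms. *)
  assert (K : exists K, incl s (map Z.of_nat (seq 0 K) ++
                               map (fun k => (- Z.of_nat k)%Z) (seq 0 K))).
  { clear Hs. induction s as [|n s [K IH]].
    - exists O. intros ? [].
    - exists (K + S (Z.abs_nat n))%nat.
      assert (G : forall m, In m (map Z.of_nat (seq 0 (K + S (Z.abs_nat n))) ++
         map (fun k => (- Z.of_nat k)%Z) (seq 0 (K + S (Z.abs_nat n)))) <->
         (Z.abs m < Z.of_nat (K + S (Z.abs_nat n)))%Z).
      { intros m. rewrite in_app_iff, !in_map_iff. split.
        - intros [(k & <- & Hk)|(k & <- & Hk)]; apply in_seq in Hk; lia.
        - intros Hm. destruct (Z_le_gt_dec 0 m).
          + left. exists (Z.to_nat m). split; [lia | apply in_seq; lia].
          + right. exists (Z.to_nat (- m)). split; [lia | apply in_seq; lia]. }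
      intros m [<-|Hm]; apply G; [lia |].
      apply IH, in_app_iff in Hm. rewrite !in_map_iff in Hm.
      destruct Hm as [(k & <- & Hk)|(k & <- & Hk)]; apply in_seq in Hk; lia. }
  destruct K as [K HK].
  eapply Rle_trans; [apply (rsum_incl _ _ _ (fun i => Rlt_le _ _ (exp_pos _)) Hs HK) |].
  rewrite rsum_app, !rsum_map.
  assert (E : forall k : nat, exp (- (r * INR k)) = (x ^ k)%R).
  { intros k. unfold x. rewrite <- exp_pow. f_equal. ring. }
  apply Rplus_le_compat; eapply Rle_trans; try apply (geometric_bound x K Hx);
    apply rsum_le; intros k; apply Req_le; rewrite <- E; do 3 f_equal.
  - rewrite <- INR_IZR_INZ. apply Rabs_pos_eq, pos_INR.
  - rewrite opp_IZR, Rabs_Ropp, <- INR_IZR_INZ. apply Rabs_pos_eq, pos_INR.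
Qed.

Lemma has_sum_Cmod_le {I : Type} (f : I -> C) (l : C) (g : I -> R) (B c : R) :
  (0 <= c)%R -> (forall i, (Cmod (f i) <= c * g i)%R) ->
  (forall s, NoDup s -> (rsum g s <= B)%R) ->
  has_sum f l -> (Cmod l <= c * B)%R.
Proof.
  intros Hc Hf HB Hl. replace l with (l - 0) by ring.
  apply (tends_to_Cmod_le finite_subsets (csum f)); auto.
  exists nil. intros s Hs _. replace (csum f s - 0) with (csum f s) by ring.
  eapply Rle_trans; [apply Cmod_csum_le |].
  eapply Rle_trans; [apply rsum_le, Hf |].
  rewrite rsum_scal. apply Rmult_le_compat_l; auto.
Qed.

Lemma exp_le_compat (x y : R) : (x <= y)%R -> (exp x <= exp y)%R.
Proof.
  intros [H| ->]; [left; now apply exp_increasing | apply Rle_refl].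
Qed.

(** * The exponential e(s) = exp(2 pi i s) *)

Definition expi (s : C) : C := Cexp (RtoC (2 * PI) * Ci * s).

Lemma epow_expi (z : C) (r : R) : epow z r = expi (RtoC r * z).
Proof. unfold epow, expi. f_equal. ring. Qed.

Lemma Cexp_plus (a b : C) : Cexp (a + b) = Cexp a * Cexp b.
Proof.
  destruct a as [a1 a2], b as [b1 b2]. unfold Cexp, Cplus, Cmult, Re, Im; simpl.
  rewrite exp_plus, cos_plus, sin_plus. f_equal; ring.
Qed.

Lemma expi_plus (a b : C) : expi (a + b) = expi a * expi b.
Proof. unfold expi. rewrite <- Cexp_plus. f_equal. ring. Qed.

Lemma expi_pair (x y : R) :
  expi (x, y) = (exp (- (2 * PI * y)) * cos (2 * PI * x),
                 exp (- (2 * PI * y)) * sin (2 * PI * x))%R.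
Proof.
  unfold expi.
  replace (RtoC (2 * PI) * Ci * (x, y)) with (- (2 * PI * y), 2 * PI * x)%R.
  - reflexivity.
  - unfold Ci, RtoC, Cmult; simpl. f_equal; ring.
Qed.

Lemma expi_0 : expi 0 = 1.
Proof.
  unfold RtoC. rewrite expi_pair.
  replace (- (2 * PI * 0))%R with 0%R by ring. rewrite Rmult_0_r, exp_0, cos_0, sin_0.
  f_equal; ring.
Qed.

Lemma expi_neq_0 (a : C) : expi a <> 0.
Proof.
  intros H. apply C1_nz. rewrite <- expi_0.
  replace (RtoC 0) with (a + - a) at 1 by ring. rewrite expi_plus, H. ring.
Qed.

Lemma expi_opp (a : C) : expi (- a) = / expi a.
Proof.
  assert (E : expi a * expi (- a) = 1).
  { rewrite <- expi_plus. replace (a + - a) with (RtoC 0) by ring. apply expi_0. }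
  rewrite <- (Cmult_1_l (/ expi a)), <- E. field. apply expi_neq_0.
Qed.

Lemma Cmod_expi (s : C) : Cmod (expi s) = exp (- (2 * PI * Im s)).
Proof.
  destruct s as [x y]. rewrite expi_pair. unfold Cmod; simpl.
  rewrite <- (sqrt_square (exp (- (2 * PI * y)))) by (left; apply exp_pos).
  f_equal. rewrite sqrt_square by (left; apply exp_pos).
  pose proof (sin2_cos2 (2 * PI * x)) as E. unfold Rsqr in E.
  transitivity (exp (- (2 * PI * y)) * exp (- (2 * PI * y)) *
    (sin (2 * PI * x) * sin (2 * PI * x) + cos (2 * PI * x) * cos (2 * PI * x)))%R;
    [ring | rewrite E; ring].
Qed.

Lemma expi_half : expi (1 / 2) = - (1).
Proof.
  replace (1 / 2) with ((1 / 2)%R, 0%R).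
  2:{ replace (1 / 2) with (RtoC (1 / 2)) by (now rewrite RtoC_div by lra). reflexivity. }
  rewrite expi_pair. replace (2 * PI * (1 / 2))%R with PI by field.
  replace (- (2 * PI * 0))%R with 0%R by ring.
  rewrite exp_0, cos_PI, sin_PI. unfold RtoC, Copp; simpl. f_equal; ring.
Qed.

Lemma expi_quarter : expi (1 / 4) = Ci.
Proof.
  replace (1 / 4) with ((1 / 4)%R, 0%R).
  2:{ replace (1 / 4) with (RtoC (1 / 4)) by (now rewrite RtoC_div by lra). reflexivity. }
  rewrite expi_pair. replace (2 * PI * (1 / 4))%R with (PI / 2)%R by field.
  replace (- (2 * PI * 0))%R with 0%R by ring.
  rewrite exp_0, cos_PI2, sin_PI2. unfold Ci. f_equal; ring.
Qed.

Definition zc (n : Z) : C := RtoC (IZR n).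

Lemma zc_add (m n : Z) : zc (m + n) = zc m + zc n.
Proof. unfold zc. now rewrite plus_IZR, RtoC_plus. Qed.
Lemma zc_opp (m : Z) : zc (- m) = - zc m.
Proof. unfold zc. now rewrite opp_IZR, RtoC_opp. Qed.
Lemma zc_sub (m n : Z) : zc (m - n) = zc m - zc n.
Proof. unfold zc. now rewrite minus_IZR, RtoC_minus. Qed.
Lemma zc_mul (m n : Z) : zc (m * n) = zc m * zc n.
Proof. unfold zc. now rewrite mult_IZR, RtoC_mult. Qed.
Lemma zc_0 : zc 0 = 0. Proof. reflexivity. Qed.
Lemma zc_1 : zc 1 = 1. Proof. reflexivity. Qed.

Lemma expi_zc (n : Z) : expi (zc n) = 1.
Proof.
  assert (H1 : expi 1 = 1).
  { replace (RtoC 1) with (1 / 2 + 1 / 2) at 1 by field. rewrite expi_plus, expi_half. ring. }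
  induction n as [|n IH|n IH] using Z.peano_ind.
  - apply expi_0.
  - unfold Z.succ. now rewrite zc_add, expi_plus, IH, zc_1, H1, Cmult_1_l.
  - rewrite <- Z.sub_1_r, zc_sub. unfold Cminus.
    rewrite expi_plus, IH, expi_opp, zc_1, H1. field.
Qed.

Lemma expi_real_eq_1 (x : R) : expi (RtoC x) = 1 -> exists k : Z, x = IZR k.
Proof.
  unfold RtoC at 1. rewrite expi_pair. intros H. injection H as H _.
  replace (- (2 * PI * 0))%R with 0%R in H by ring. rewrite exp_0 in H.
  replace (2 * PI * x)%R with (2 * (PI * x))%R in H by ring.
  (* As [cos (2 t) = 1 - 2 sin^2 t], the real part alone forces [sin (PI * x) = 0]. *)
  rewrite cos_2a_sin in H.
  destruct (sin_eq_0_0 (PI * x)) as [k Hk]; [nra |].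
  exists k. apply (Rmult_eq_reg_l PI); [lra | apply Rgt_not_eq, PI_RGT_0].
Qed.

Ltac zpush := rewrite ?zc_mul, ?zc_add, ?zc_sub, ?zc_opp, ?zc_mul, ?zc_add, ?zc_sub,
  ?zc_opp, ?zc_0, ?zc_1.

Lemma Im_zc_mult (n : Z) (b : C) : Im (zc n * b) = (IZR n * Im b)%R.
Proof. apply im_scal_l. Qed.

(** * Laurent series with rapidly decreasing coefficients *)

(** Decay beyond every exponential rate makes the Laurent series converge for every [b], that is, on
    the whole punctured plane of [e(b)]. *)
Definition fast (c : Z -> C) : Prop :=
  forall rho : R, exists M : R, (0 <= M)%R /\
    forall k, (Cmod (c k) <= M * exp (- (rho * Rabs (IZR k))))%R.

Definition laurent (c : Z -> C) (b : C) : C := Csum (fun k => c k * expi (zc k * b)).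

Lemma fast_term_bound (c : Z -> C) (B : R) : fast c ->
  exists M : R, (0 <= M)%R /\ forall k b, (Rabs (Im b) <= B)%R ->
    (Cmod (c k * expi (zc k * b)) <= M * exp (- (1 * Rabs (IZR k))))%R.
Proof.
  (* The part [2 PI B] of the rate pays for the growth of [e(k b)] in the strip; the remaining 1
     leaves a summable majorant independent of [b]. *)
  intros H. destruct (H (1 + 2 * PI * B)%R) as (M & HM & Hk).
  exists M. split; auto. intros k b Hb.
  rewrite Cmod_mult, Cmod_expi, Im_zc_mult.
  apply Rle_trans with (M * exp (- ((1 + 2 * PI * B) * Rabs (IZR k)))
                          * exp (2 * PI * B * Rabs (IZR k)))%R.
  - apply Rmult_le_compat; auto; [apply Cmod_ge_0 | left; apply exp_pos |].
    apply exp_le_compat.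
    apply Rle_trans with (2 * PI * (Rabs (IZR k) * Rabs (Im b)))%R.
    + rewrite <- Rabs_mult, <- (Rabs_Ropp (_ * _)).
      replace (- (2 * PI * (IZR k * Im b)))%R with (2 * PI * - (IZR k * Im b))%R by ring.
      apply Rmult_le_compat_l; [pose proof PI_RGT_0; lra | apply Rle_abs].
    + replace (2 * PI * B * Rabs (IZR k))%R with (2 * PI * (Rabs (IZR k) * B))%R by ring.
      apply Rmult_le_compat_l; [pose proof PI_RGT_0; lra |].
      apply Rmult_le_compat_l; [apply Rabs_pos | auto].
  - rewrite Rmult_assoc, <- exp_plus. apply Req_le. do 2 f_equal. ring.
Qed.

Lemma fast_summable (c : Z -> C) (b : C) : fast c ->
  summable (fun k => Cmod (c k * expi (zc k * b))).
Proof.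
  intros H. destruct (fast_term_bound c (Rabs (Im b)) H) as (M & HM & Hk).
  eapply summable_le; [intros k; apply Hk, Rle_refl |].
  apply summable_scal; auto. apply summable_exp. lra.
Qed.

Lemma laurent_has_sum (c : Z -> C) (b : C) : fast c ->
  has_sum (fun k => c k * expi (zc k * b)) (laurent c b).
Proof. intros H. apply summable_has_sum. now apply fast_summable. Qed.

Lemma laurent_0 (c : Z -> C) : fast c -> has_sum c (laurent c 0).
Proof.
  intros H. generalize (laurent_has_sum c 0 H). apply has_sum_ext.
  intros k. replace (zc k * 0) with (RtoC 0) by ring. rewrite expi_0. ring.
Qed.

Lemma laurent_periodic (c : Z -> C) (b : C) (n : Z) :
  laurent c (b + zc n) = laurent c b.
Proof.
  unfold laurent, Csum. f_equal. apply functional_extensionality.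
  intros s. f_equal. apply map_ext. intros k.
  replace (zc k * (b + zc n)) with (zc k * b + zc (k * n)) by (zpush; ring).
  rewrite expi_plus, expi_zc. ring.
Qed.

Lemma tends_to_expi_vertical (b : C) (y : R) :
  tends_to (at_right 0) (fun e => expi (b + Ci * RtoC (y * e))) (expi b).
Proof.
  replace (expi b) with (expi b * RtoC 1) by ring.
  apply tends_to_ext with (fun e => expi b * RtoC (exp (- (2 * PI * (y * e))))).
  - typeclasses eauto.
  - apply filter_forall. intros e. rewrite expi_plus. f_equal.
    replace (Ci * RtoC (y * e)) with (0%R, (y * e)%R)
      by (unfold Ci, RtoC, Cmult; simpl; f_equal; ring).
    rewrite expi_pair, Rmult_0_r, cos_0, sin_0. unfold RtoC. f_equal; ring.
  - apply (tends_to_mult (at_right 0) (fun _ => expi b)).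
    { apply tends_to_const. typeclasses eauto. }
    intros eps He.
    assert (K : continuous (fun e => exp (- (2 * PI * (y * e)))) 0).
    { apply (ex_derive_continuous (K := R_AbsRing) (V := R_NormedModule)).
      auto_derive. auto. }
    assert (P : locally 0 (fun e => (Rabs (exp (- (2 * PI * (y * e))) - 1) < eps)%R)).
    { generalize (K (fun z => (Rabs (z - 1) < eps)%R)). intros K'. apply K'.
      exists (mkposreal eps He). intros z Hz.
      replace (- (2 * PI * (y * 0)))%R with 0%R in Hz by ring. rewrite exp_0 in Hz.
      exact Hz. }
    unfold at_right. eapply filter_imp; [|apply filter_le_within, P].
    intros e H. rewrite <- RtoC_minus, Cmod_R. exact H.
Qed.

Lemma at_right_lt (d : R) : (0 < d)%R -> at_right 0 (fun e => (0 < e < d)%R).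
Proof.
  intros Hd. exists (mkposreal d Hd). intros e He H0.
  unfold ball in He; simpl in He; unfold AbsRing_ball, abs, minus, plus, opp in He;
    simpl in He. rewrite Ropp_0, Rplus_0_r, Rabs_pos_eq in He; lra.
Qed.

Lemma laurent_tends_to (c : Z -> C) (b : C) (y : R) : fast c ->
  tends_to (at_right 0) (fun e => laurent c (b + Ci * RtoC (y * e))) (laurent c b).
Proof.
  intros H.
  destruct (fast_term_bound c (Rabs (Im b) + Rabs y)%R H) as (M & HM & Hk).
  apply (dominated_convergence (at_right 0)
    (fun e k => c k * expi (zc k * (b + Ci * RtoC (y * e))))
    (fun k => c k * expi (zc k * b)) _ _
    (fun k => M * exp (- (1 * Rabs (IZR k))))%R).
  - apply summable_scal; auto. apply summable_exp. lra.
  - apply (filter_imp (fun e => (0 < e < 1)%R)); [|apply at_right_lt; lra].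
    intros e He k. apply Hk.
    replace (Im (b + Ci * RtoC (y * e))) with (Im b + y * e)%R
      by (destruct b; unfold Ci, RtoC, Cmult, Cplus, Im; simpl; ring).
    eapply Rle_trans; [apply Rabs_triang |]. apply Rplus_le_compat_l.
    rewrite Rabs_mult, (Rabs_pos_eq e) by lra. pose proof (Rabs_pos y). nra.
  - intros k. apply Hk. pose proof (Rabs_pos y). lra.
  - intros k. apply (tends_to_mult (at_right 0) (fun _ => c k)).
    + apply tends_to_const. typeclasses eauto.
    + eapply tends_to_ext; [typeclasses eauto | |apply (tends_to_expi_vertical _ (IZR k * y))].
      apply filter_forall. intros e. simpl. f_equal. unfold zc.
      rewrite !RtoC_mult. ring.
  - apply filter_forall. intros e. now apply laurent_has_sum.
  - now apply laurent_has_sum.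
Qed.

(** Completing the square: the two sides differ by [(2 l x - r)^2 / (4 l)]. This trades Gaussian
    decay for exponential decay of any prescribed rate. *)
Lemma quadratic_bound (l r x : R) :
  (0 < l)%R -> (- (l * x ^ 2) + r * x <= r ^ 2 / (4 * l))%R.
Proof.
  intros Hl. apply (Rmult_le_reg_r (4 * l)); [lra |].
  replace (r ^ 2 / (4 * l) * (4 * l))%R with (r ^ 2)%R by (field; lra).
  pose proof (pow2_ge_0 (2 * l * x - r)). nra.
Qed.

(** * The theta series *)

Section Theta.

Variable T : C.
Hypothesis HT : (0 < Im T)%R.

(** The sign [(-1)^k] is kept in the exponential as [e(k/2)], so that coefficient identities become
    identities between exponents and nonvanishing is immediate. *)
Definition theta_coef (k : Z) : C := expi (zc k / 2 + zc k * (zc k - 1) / 2 * T).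

Lemma Cmod_theta_coef (k : Z) :
  Cmod (theta_coef k) = exp (- (PI * Im T * (IZR k * (IZR k - 1)))).
Proof.
  unfold theta_coef. rewrite Cmod_expi. f_equal.
  replace (zc k / 2 + zc k * (zc k - 1) / 2 * T)
    with (RtoC (IZR k / 2) + RtoC (IZR k * (IZR k - 1) / 2) * T).
  - destruct T as [u v]. unfold RtoC, Cplus, Cmult, Im; simpl. field.
  - unfold zc. rewrite !RtoC_div, RtoC_mult, RtoC_minus by lra. reflexivity.
Qed.

Lemma theta_coef_fast : fast theta_coef.
Proof.
  intros rho. set (l := (PI * Im T)%R).
  assert (Hl : (0 < l)%R) by (apply Rmult_lt_0_compat; [apply PI_RGT_0 | exact HT]).
  (* The maximum of [- l x^2 + (l + rho) x]: the linear term of [k (k - 1)] costs [l], the requested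
     rate costs [rho]. *)
  exists (exp ((l + rho) ^ 2 / (4 * l))). split; [left; apply exp_pos |].
  intros k. rewrite Cmod_theta_coef, <- exp_plus. apply exp_le_compat. fold l.
  pose proof (quadratic_bound l (l + rho) (Rabs (IZR k)) Hl) as Q.
  rewrite pow2_abs in Q. pose proof (Rle_abs (IZR k)). nra.
Qed.

Lemma theta_coef_0 : theta_coef 0 = 1.
Proof.
  unfold theta_coef. rewrite zc_0.
  replace (0 / 2 + 0 * (0 - 1) / 2 * T) with (RtoC 0) by field. apply expi_0.
Qed.

Lemma theta_coef_add (m k : Z) :
  theta_coef (m + k) = theta_coef m * theta_coef k * expi (zc (m * k) * T).
Proof.
  unfold theta_coef. rewrite <- !expi_plus. f_equal. zpush. field.
Qed.

Lemma theta_coef_1 : theta_coef 1 = - (1).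
Proof.
  unfold theta_coef. rewrite zc_1, <- expi_half. f_equal. field.
Qed.

Lemma theta_coef_succ (k : Z) :
  theta_coef (k + 1) = - expi (zc k * T) * theta_coef k.
Proof. rewrite theta_coef_add, theta_coef_1, Z.mul_1_r. ring. Qed.

Lemma theta_coef_reflect (k : Z) : theta_coef (1 - k) = - theta_coef k.
Proof.
  (* The factor [e(-k) = 1] is inserted so that the exponents agree exactly. *)
  replace (- theta_coef k) with (expi (1 / 2) * expi (zc (- k)) * theta_coef k)
    by (rewrite expi_half, expi_zc; ring).
  unfold theta_coef. rewrite <- !expi_plus. f_equal. zpush. field.
Qed.

Definition jtheta (b : C) : C := laurent theta_coef b.

(** The reflection [k -> 1 - k] permutes the terms and negates each of them, so the sum equals its
    own negative. *)
Lemma has_sum_theta_coef : has_sum theta_coef 0.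
Proof.
  pose proof (laurent_0 _ theta_coef_fast) as H.
  replace (RtoC 0) with (laurent theta_coef 0); auto.
  assert (E : laurent theta_coef 0 = - (1) * laurent theta_coef 0).
  { apply (has_sum_unique (fun k => theta_coef (1 - k)%Z)).
    - apply (has_sum_bij (fun k => (1 - k)%Z) (fun k => (1 - k)%Z)); auto; intros; ring.
    - apply (has_sum_ext (fun k => - (1) * theta_coef k)).
      + intros k. rewrite theta_coef_reflect. ring.
      + now apply has_sum_scal. }
  set (x := laurent theta_coef 0) in *.
  assert (E2 : 2 * x = 0) by (replace (2 * x) with (x + x) by ring; rewrite E at 2; ring).
  replace x with (/ 2 * (2 * x)) by field. rewrite E2. ring.
Qed.

Lemma jtheta_shift (m : Z) (b : C) :
  jtheta b = theta_coef m * expi (zc m * b) * jtheta (b + zc m * T).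
Proof.
  apply (has_sum_unique (fun k => theta_coef (k + m) * expi (zc (k + m) * b))).
  - apply (has_sum_shift (fun k => theta_coef k * expi (zc k * b))).
    apply laurent_has_sum, theta_coef_fast.
  - eapply has_sum_ext; [|apply has_sum_scal, laurent_has_sum, theta_coef_fast].
    intros k. simpl. rewrite theta_coef_add.
    replace (zc k * (b + zc m * T)) with (zc k * b + zc (k * m) * T) by (zpush; ring).
    rewrite zc_add, Cmult_plus_distr_r, !expi_plus. ring.
Qed.

Definition theta_psum (k : Z) : C :=
  Csum (fun j => if (j <=? k)%Z then theta_coef j else 0).

Lemma summable_theta_coef : summable (fun j => Cmod (theta_coef j)).
Proof.
  generalize (fast_summable _ 0 theta_coef_fast). apply summable_le.
  intros k. replace (zc k * 0) with (RtoC 0) by ring. rewrite expi_0, Cmult_1_r.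
  apply Rle_refl.
Qed.

Lemma summable_theta_coef_if (P : Z -> bool) :
  summable (fun j => Cmod (if P j then theta_coef j else 0)).
Proof.
  generalize summable_theta_coef. apply summable_le.
  intros k. destruct (P k); [apply Rle_refl | rewrite Cmod_0; apply Cmod_ge_0].
Qed.

Lemma theta_psum_has_sum (k : Z) :
  has_sum (fun j => if (j <=? k)%Z then theta_coef j else 0) (theta_psum k).
Proof. apply summable_has_sum, summable_theta_coef_if. Qed.

(** As the total is zero, a partial sum is also minus the complementary tail. This controls it for
    large positive [k]. *)
Lemma theta_psum_has_sum_gt (k : Z) :
  has_sum (fun j => if (k <? j)%Z then theta_coef j else 0) (- theta_psum k).
Proof.
  replace (- theta_psum k) with (0 + - (1) * theta_psum k) by ring.
  eapply has_sum_ext;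
    [|apply has_sum_plus; [apply has_sum_theta_coef | apply has_sum_scal, theta_psum_has_sum]].
  intros j. simpl. destruct (Z.ltb_spec k j), (Z.leb_spec j k); try lia; ring.
Qed.

Lemma theta_psum_pred (k : Z) : theta_psum k = theta_psum (k - 1) + theta_coef k.
Proof.
  apply (has_sum_unique _ _ _ (theta_psum_has_sum k)).
  eapply has_sum_ext; [|apply has_sum_plus; [apply theta_psum_has_sum |
    apply (has_sum_single k (fun j => if (j =? k)%Z then theta_coef j else 0));
      [now rewrite Z.eqb_refl |]]].
  - intros j. simpl. destruct (Z.leb_spec j k), (Z.leb_spec j (k - 1)), (Z.eqb_spec j k);
      try lia; ring.
  - intros j Hj. destruct (Z.eqb_spec j k); tauto.
Qed.

Lemma theta_psum_fast : fast theta_psum.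
Proof.
  intros rho.
  assert (W : exists M, (0 <= M)%R /\
    forall k, (Cmod (theta_psum k) <= M * exp (- (Rabs rho * Rabs (IZR k))))%R).
  (* Every relevant [j] satisfies [|j| >= |k|]. A nonnegative rate, hence [Rabs rho], transfers the
     decay from [j] to [k], and the extra 1 leaves a majorant summable over [j]. *)
  { destruct (theta_coef_fast (Rabs rho + 1)%R) as (M & HM & Hk).
    destruct (summable_exp 1 Rlt_0_1) as [B HB].
    assert (PB : (0 <= B)%R) by (eapply Rle_trans; [|apply (HB nil); constructor];
      unfold rsum; simpl; lra).
    exists (M * B)%R. split; [now apply Rmult_le_pos |]. intros k.
    set (X := (M * exp (- (Rabs rho * Rabs (IZR k))))%R).
    replace (M * B * exp (- (Rabs rho * Rabs (IZR k))))%R with (X * B)%R by (unfold X; ring).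
    assert (PX : (0 <= X)%R) by (apply Rmult_le_pos; [auto | left; apply exp_pos]).
    assert (G : forall j, (Rabs (IZR k) <= Rabs (IZR j))%R ->
      (Cmod (theta_coef j) <= X * exp (- (1 * Rabs (IZR j))))%R).
    { intros j Hj. eapply Rle_trans; [apply Hk |]. unfold X.
      rewrite Rmult_assoc, <- exp_plus. apply Rmult_le_compat_l; auto.
      apply exp_le_compat. pose proof (Rabs_pos rho). nra. }
    assert (P0 : forall j : Z, (Cmod 0 <= X * exp (- (1 * Rabs (IZR j))))%R).
    { intros j. rewrite Cmod_0. apply Rmult_le_pos; auto. left; apply exp_pos. }
    (* The tail that points away from the origin is used: [j <= k] for negative [k], [j > k]
       otherwise. *)
    destruct (Z_lt_le_dec k 0) as [Hneg|Hpos].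
    - eapply has_sum_Cmod_le; [exact PX | | exact HB | apply (theta_psum_has_sum k)].
      intros j. simpl. destruct (Z.leb_spec j k); auto. apply G.
      rewrite <- !abs_IZR. apply IZR_le. lia.
    - rewrite <- Cmod_opp.
      eapply has_sum_Cmod_le; [exact PX | | exact HB | apply (theta_psum_has_sum_gt k)].
      intros j. simpl. destruct (Z.ltb_spec k j); auto. apply G.
      rewrite <- !abs_IZR. apply IZR_le. lia. }
  destruct W as (M & HM & H). exists M. split; auto. intros k.
  eapply Rle_trans; [apply H |]. apply Rmult_le_compat_l; auto. apply exp_le_compat.
  pose proof (Rle_abs rho). pose proof (Rabs_pos (IZR k)). nra.
Qed.

(* D(e(b)) in the notation of the header. *)
Definition jtheta_red (b : C) : C := laurent theta_psum b.

Lemma jtheta_factor (b : C) : jtheta b = (1 - expi b) * jtheta_red b.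
Proof.
  apply (has_sum_unique (fun k => theta_coef k * expi (zc k * b))).
  - apply laurent_has_sum, theta_coef_fast.
  - pose proof (laurent_has_sum _ b theta_psum_fast) as H.
    replace ((1 - expi b) * jtheta_red b)
      with (jtheta_red b + - expi b * jtheta_red b) by ring.
    eapply has_sum_ext; [|apply has_sum_plus; [exact H |
      apply has_sum_scal, (has_sum_shift _ (-1) _ H)]].
    intros k. simpl. rewrite (theta_psum_pred k).
    replace (k + -1)%Z with (k - 1)%Z by ring.
    replace (zc k * b) with (zc (k - 1) * b + b) by (zpush; ring).
    rewrite expi_plus. ring.
Qed.

End Theta.

Lemma has_sum_row (g : Z -> C) (n : Z) (l : C) :
  has_sum g l ->
  has_sum (fun p : Z * Z => if (snd p =? n)%Z then g (fst p) else 0) l.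
Proof.
  intros H. apply (has_sum_inj (fun k => (k, n))).
  - intros i j E. now injection E.
  - intros [i j] N. simpl. destruct (Z.eqb_spec j n) as [->|]; auto.
    now destruct (N i).
  - simpl. now rewrite Z.eqb_refl.
Qed.

(** * The product of the theta series with the Kronecker series *)

Section Lattice.

Variables (T a : C) (N : Z).
Hypothesis HT : (0 < Im T)%R.
Hypothesis HN : (0 < IZR N * Im T + Im a < Im T)%R.

(* [chi2] with the row [n2 = 0] removed; [N] is the least [n1] with
   [n1 + Im a / Im T > 0]. *)
Definition chi_off (n1 n2 : Z) : C :=
  if ((N <=? n1) && (1 <=? n2))%Z then 1
  else if ((n1 <? N) && (n2 <=? -1))%Z then - (1) else 0.

Definition off_term (b : C) (p : Z * Z) : C :=
  chi_off (fst p) (snd p) *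
  expi (zc (fst p) * zc (snd p) * T + zc (snd p) * a + zc (fst p) * b).

(** With [g = s / V] the exponent factors as [(x V + A) (y + g) - A g]. On the two quadrants the
    factors have equal signs and are bounded away from zero, so their product dominates a multiple
    of [|x| + |y|]. *)
Lemma off_exponent_bound (s : R) : (Rabs s < Im T)%R ->
  exists c K : R, (0 < c)%R /\ forall n1 n2 : Z,
    ((N <= n1)%Z /\ (1 <= n2)%Z) \/ ((n1 < N)%Z /\ (n2 <= -1)%Z) ->
    (c * Rabs (IZR n1) + c * Rabs (IZR n2) - K
       <= IZR n1 * IZR n2 * Im T + IZR n2 * Im a + IZR n1 * s)%R.
Proof.
  intros Hs. set (V := Im T) in *. set (A := Im a) in *.
  set (d := (IZR N * V + A)%R) in *. set (g := (s / V)%R).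
  assert (Es : s = (g * V)%R) by (unfold g; field; lra).
  assert (Hg : (Rabs g < 1)%R).
  { unfold g, Rdiv. rewrite Rabs_mult, (Rabs_pos_eq (/ V))
      by (left; now apply Rinv_0_lt_compat).
    apply (Rmult_lt_reg_r V); auto. rewrite Rmult_assoc, Rinv_l by lra. lra. }
  assert (Hg1 : (g <= Rabs g)%R) by apply Rle_abs.
  assert (Hg2 : (- g <= Rabs g)%R) by (rewrite <- Rabs_Ropp; apply Rle_abs).
  (* Since [|y| >= 1] on the support, [|y + g| >= k |y|]. *)
  set (k := (1 - Rabs g)%R). assert (Hk : (0 < k)%R) by (unfold k; lra).
  (* The values [n1 V + A] for [n1 = N] and [n1 = N - 1] are [d] and [d - V], so [e] bounds the
     first factor away from zero on both sides. *)
  set (e := Rmin d (V - d)).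
  assert (He : (0 < e)%R) by (apply Rmin_pos; lra).
  assert (He1 : (e <= d)%R) by apply Rmin_l.
  assert (He2 : (e <= V - d)%R) by apply Rmin_r.
  exists (k * e)%R, (k * e * (Rabs (IZR N) + 1) + A * g)%R.
  split; [now apply Rmult_lt_0_compat |].
  intros n1 n2 H.
  set (x := IZR n1). set (y := IZR n2).
  replace (x * y * V + y * A + x * s)%R with ((x * V + A) * (y + g) - A * g)%R
    by (rewrite Es; ring).
  replace A with (d - IZR N * V)%R at 2 by (unfold d; ring).
  assert (AN : (- IZR N <= Rabs (IZR N))%R) by (rewrite <- Rabs_Ropp; apply Rle_abs).
  assert (AN2 : (IZR N <= Rabs (IZR N))%R) by apply Rle_abs.
  enough (G : (e * (Rabs x + Rabs y - (Rabs (IZR N) + 1)) * k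
               <= (x * V + (d - IZR N * V)) * (y + g))%R) by lra.
  destruct H as [[H1 H2]|[H1 H2]].
  - apply IZR_le in H1, H2. fold x in H1. fold y in H2.
    rewrite (Rabs_pos_eq y) by lra.
    assert (AX : (Rabs x <= (x - IZR N) + Rabs (IZR N))%R).
    { replace x with ((x - IZR N) + IZR N)%R at 1 by ring.
      eapply Rle_trans; [apply Rabs_triang |]. rewrite (Rabs_pos_eq (x - _)); lra. }
    replace (x * V + (d - IZR N * V))%R with ((x - IZR N) * V + d)%R by ring.
    set (w := (x - IZR N)%R) in *. assert (Hw : (0 <= w)%R) by (unfold w; lra).
    assert (Q1 : (k * y <= y + g)%R) by (unfold k; nra).
    assert (Q2 : (e * (w + y) <= (w * V + d) * y)%R).
    { assert (w * e <= w * V)%R by (apply Rmult_le_compat_l; lra).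
      assert (w * V * 1 <= w * V * y)%R by (apply Rmult_le_compat_l; nra).
      assert (e * y <= d * y)%R by (apply Rmult_le_compat_r; lra). nra. }
    assert (P : (0 <= w * V + d)%R) by nra.
    apply Rle_trans with ((w * V + d) * (k * y))%R;
      [|apply Rmult_le_compat_l; auto].
    replace ((w * V + d) * (k * y))%R with ((w * V + d) * y * k)%R by ring.
    apply Rmult_le_compat_r; [lra |].
    eapply Rle_trans; [|exact Q2]. apply Rmult_le_compat_l; lra.
  - assert (H1' : (n1 + 1 <= N)%Z) by lia. apply IZR_le in H1', H2.
    rewrite plus_IZR in H1'. fold x in H1'. fold y in H2.
    rewrite (Rabs_left1 y) by lra.
    set (w := (IZR N - 1 - x)%R) in *. assert (Hw : (0 <= w)%R) by (unfold w; lra).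
    assert (AX : (Rabs x <= w + Rabs (IZR N) + 1)%R).
    { replace x with ((IZR N + - 1) + - w)%R by (unfold w; ring).
      eapply Rle_trans; [apply Rabs_triang |]. rewrite Rabs_Ropp, (Rabs_pos_eq w) by lra.
      pose proof (Rabs_triang (IZR N) (- 1)) as Q.
      rewrite (Rabs_left (- 1)) in Q by lra. lra. }
    replace ((x * V + (d - IZR N * V)) * (y + g))%R
      with ((w * V + (V - d)) * (- y - g))%R by (unfold w; ring).
    set (u := (- y)%R) in *. assert (Hu : (1 <= u)%R) by (unfold u; lra).
    assert (Q1 : (k * u <= u - g)%R) by (unfold k; nra).
    assert (Q2 : (e * (w + u) <= (w * V + (V - d)) * u)%R).
    { assert (w * e <= w * V)%R by (apply Rmult_le_compat_l; lra).
      assert (w * V * 1 <= w * V * u)%R by (apply Rmult_le_compat_l; nra).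
      assert (e * u <= (V - d) * u)%R by (apply Rmult_le_compat_r; lra). nra. }
    assert (P : (0 <= w * V + (V - d))%R) by nra.
    apply Rle_trans with ((w * V + (V - d)) * (k * u))%R;
      [|apply Rmult_le_compat_l; auto].
    replace ((w * V + (V - d)) * (k * u))%R with ((w * V + (V - d)) * u * k)%R by ring.
    apply Rmult_le_compat_r; [lra |].
    eapply Rle_trans; [|exact Q2]. apply Rmult_le_compat_l; lra.
Qed.

Lemma summable_off (b : C) : (Rabs (Im b) < Im T)%R ->
  summable (fun p => Cmod (off_term b p)).
Proof.
  intros Hb. destruct (off_exponent_bound (Im b) Hb) as (c & K & Hc & H).
  pose proof PI_RGT_0 as HPI.
  assert (Hc2 : (0 < 2 * PI * c)%R) by (apply Rmult_lt_0_compat; lra).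
  eapply summable_le; [|apply (summable_scal (exp (2 * PI * K)));
    [left; apply exp_pos |
     apply (summable_prod (fun n : Z => exp (- (2 * PI * c * Rabs (IZR n))))
                          (fun n : Z => exp (- (2 * PI * c * Rabs (IZR n)))));
       try (intros; left; apply exp_pos); now apply summable_exp]].
  intros [n1 n2]. unfold off_term; simpl.
  assert (P : (0 <= exp (2 * PI * K) * (exp (- (2 * PI * c * Rabs (IZR n1))) *
                exp (- (2 * PI * c * Rabs (IZR n2)))))%R).
  { repeat apply Rmult_le_pos; left; apply exp_pos. }
  assert (G : ((N <= n1)%Z /\ (1 <= n2)%Z) \/ ((n1 < N)%Z /\ (n2 <= -1)%Z) ->
    (Cmod (expi (zc n1 * zc n2 * T + zc n2 * a + zc n1 * b)) <=
      exp (2 * PI * K) * (exp (- (2 * PI * c * Rabs (IZR n1))) *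
                exp (- (2 * PI * c * Rabs (IZR n2)))))%R).
  { intros D. rewrite Cmod_expi, <- !exp_plus. apply exp_le_compat.
    replace (Im (zc n1 * zc n2 * T + zc n2 * a + zc n1 * b))
      with (IZR n1 * IZR n2 * Im T + IZR n2 * Im a + IZR n1 * Im b)%R
      by (destruct T, a, b; unfold zc, RtoC, Cplus, Cmult, Im; simpl; ring).
    specialize (H n1 n2 D). nra. }
  unfold chi_off.
  destruct (Z.leb_spec N n1), (Z.leb_spec 1 n2), (Z.ltb_spec n1 N), (Z.leb_spec n2 (-1));
    simpl; try lia; rewrite Cmod_mult, ?Cmod_1, ?Cmod_m1, ?Cmod_0, ?Rmult_1_l, ?Rmult_0_l;
    auto; apply G; lia.
Qed.

Definition off_sum (b : C) : C := Csum (off_term b).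

Definition triple_term (b : C) (t : Z * (Z * Z)) : C :=
  theta_coef T (fst t) * expi (zc (fst t) * b) * off_term b (snd t).

(** Replacing the theta index by [m - n1] sorts the product by the total exponent [m] of [e(b)]; the
    substitution is injective, so summability is kept. *)
Lemma summable_triple (b : C) : (Rabs (Im b) < Im T)%R ->
  summable (fun t => Cmod (triple_term b (fst t - fst (snd t), snd t)%Z)).
Proof.
  intros Hb. apply (summable_inj
    (fun t : Z * (Z * Z) => (fst t - fst (snd t), snd t)%Z) (fun t => Cmod (triple_term b t))).
  - intros [m [n1 n2]] [m' [n1' n2']] E. simpl in E.
    injection E as E1 E2 E3. f_equal; [lia | congruence].
  - eapply summable_le; [|apply (summable_prod
      (fun k => Cmod (theta_coef T k * expi (zc k * b))) (fun p => Cmod (off_term b p)));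
      try (intros; apply Cmod_ge_0);
      [now apply fast_summable, theta_coef_fast | now apply summable_off]].
    intros t. unfold triple_term. rewrite Cmod_mult. apply Rle_refl.
Qed.

Definition prod_coef_term (m : Z) (p : Z * Z) : C :=
  chi_off (fst p) (snd p) * theta_coef T (m - fst p) *
  expi (zc (snd p) * a + zc (fst p) * zc (snd p) * T).

Lemma triple_term_eq (b : C) (m : Z) (p : Z * Z) :
  triple_term b (m - fst p, p)%Z = expi (zc m * b) * prod_coef_term m p.
Proof.
  unfold triple_term, off_term, prod_coef_term. destruct p as [n1 n2]; simpl.
  transitivity (chi_off n1 n2 * theta_coef T (m - n1) *
    (expi (zc (m - n1) * b) * expi (zc n1 * zc n2 * T + zc n2 * a + zc n1 * b))); [ring |].
  transitivity (chi_off n1 n2 * theta_coef T (m - n1) *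
    (expi (zc m * b) * expi (zc n2 * a + zc n1 * zc n2 * T))); [|ring].
  f_equal. rewrite <- !expi_plus. f_equal. zpush. ring.
Qed.

Definition prod_coef (m : Z) : C := Csum (prod_coef_term m).

Lemma prod_coef_has_sum (m : Z) : has_sum (prod_coef_term m) (prod_coef m).
Proof.
  apply summable_has_sum.
  (* The coefficients do not involve [b], so their summability can be read off from the slice [m] at
     [b = 0]. *)
  assert (H0 : (Rabs (Im 0) < Im T)%R) by (simpl; rewrite Rabs_R0; exact HT).
  pose proof (summable_inj (fun p : Z * Z => (m, p)) _
    (fun p p' E => f_equal snd E) (summable_triple 0 H0)) as H.
  revert H. apply summable_le. intros p. simpl. rewrite triple_term_eq.
  replace (zc m * 0) with (RtoC 0) by ring. rewrite expi_0, Cmult_1_l. apply Rle_refl.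
Qed.

Lemma theta_off_product (b : C) : (Rabs (Im b) < Im T)%R ->
  has_sum (fun m => expi (zc m * b) * prod_coef m) (jtheta T b * off_sum b).
Proof.
  intros Hb.
  assert (H : has_sum (triple_term b) (jtheta T b * off_sum b)).
  { apply (has_sum_prod (fun k => theta_coef T k * expi (zc k * b)) (off_term b)).
    - now apply fast_summable, theta_coef_fast.
    - now apply summable_off.
    - now apply laurent_has_sum, theta_coef_fast.
    - now apply summable_has_sum, summable_off. }
  apply (has_sum_bij (fun t : Z * (Z * Z) => (fst t - fst (snd t), snd t)%Z)
                     (fun t => (fst t + fst (snd t), snd t)%Z)) in H.
  2,3: intros [x [y z]]; simpl; f_equal; ring.
  rewrite <- (Csum_eq _ _ H).
  apply (has_sum_fubini (fun t => triple_term b (fst t - fst (snd t), snd t)%Z)).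
  - now apply summable_triple.
  - intros m. simpl.
    apply (has_sum_ext (fun p => expi (zc m * b) * prod_coef_term m p)).
    + intros p. now rewrite triple_term_eq.
    + apply has_sum_scal, prod_coef_has_sum.
Qed.

(** Under [n2 -> n2 + 1] the factor [q^n1 w] gained by each term combines with
    [t_(m+1-n1) = - q^(m-n1) t_(m-n1)] to the constant [- q^m w]. The supports before and after the
    shift differ only in the row [n2 = 0] for [n1 >= N] and the row [n2 = -1] for [n1 < N]; these
    two half-rows are the partial sums of theta coefficients. *)
Lemma prod_coef_succ (m : Z) :
  prod_coef (m + 1) = - expi (zc m * T + a) * (prod_coef m + theta_psum T (m - N))
                      - theta_psum T (m + 1 - N).
Proof.
  pose proof (prod_coef_has_sum (m + 1)) as H.
  apply (has_sum_bij (fun p : Z * Z => (fst p, snd p + 1)%Z)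
                     (fun p => (fst p, snd p - 1)%Z)) in H.
  2,3: intros [x y]; simpl; f_equal; ring.
  apply (has_sum_unique _ _ _ H).
  assert (H1 : has_sum (fun n => if (N <=? n)%Z then theta_coef T (m - n) else 0)
                 (theta_psum T (m - N))).
  { generalize (has_sum_bij (fun n => (m - n)%Z) (fun n => (m - n)%Z) _ _
      (fun n => ltac:(ring)) (fun n => ltac:(ring)) (theta_psum_has_sum T HT (m - N))).
    apply has_sum_ext. intros n. destruct (Z.leb_spec (m - n) (m - N)), (Z.leb_spec N n);
      try lia; reflexivity. }
  assert (H2 : has_sum (fun n => if (n <? N)%Z then theta_coef T (m + 1 - n) else 0)
                 (- theta_psum T (m + 1 - N))).
  { generalize (has_sum_bij (fun n => (m + 1 - n)%Z) (fun n => (m + 1 - n)%Z) _ _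
      (fun n => ltac:(ring)) (fun n => ltac:(ring)) (theta_psum_has_sum_gt T HT (m + 1 - N))).
    apply has_sum_ext. intros n.
    destruct (Z.ltb_spec (m + 1 - N) (m + 1 - n)), (Z.ltb_spec n N);
      try lia; reflexivity. }
  apply (has_sum_row _ 0) in H1. apply (has_sum_row _ (-1)) in H2.
  replace (- expi (zc m * T + a) * (prod_coef m + theta_psum T (m - N))
           - theta_psum T (m + 1 - N))
    with (- expi (zc m * T + a) * prod_coef m +
          (- expi (zc m * T + a) * theta_psum T (m - N) + - theta_psum T (m + 1 - N))) by ring.
  eapply has_sum_ext; [|apply has_sum_plus;
    [apply has_sum_scal, prod_coef_has_sum | apply has_sum_plus;
      [apply has_sum_scal, H1 | exact H2]]].
  intros [n1 n2]. unfold prod_coef_term. simpl.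
  replace (m + 1 - n1)%Z with ((m - n1) + 1)%Z by ring.
  rewrite theta_coef_succ.
  set (t := theta_coef T (m - n1)).
  assert (E : forall n2, expi (zc (m - n1) * T) * expi (zc (n2 + 1) * a + zc n1 * zc (n2 + 1) * T)
    = expi (zc m * T + a) * expi (zc n2 * a + zc n1 * zc n2 * T)).
  { intros n. rewrite <- !expi_plus. f_equal. zpush. ring. }
  assert (E' : forall c, c * (- expi (zc (m - n1) * T) * t) *
      expi (zc (n2 + 1) * a + zc n1 * zc (n2 + 1) * T)
    = - expi (zc m * T + a) * (c * t * expi (zc n2 * a + zc n1 * zc n2 * T))).
  { intros c. transitivity (- (c * t) * (expi (zc (m - n1) * T) *
      expi (zc (n2 + 1) * a + zc n1 * zc (n2 + 1) * T))); [ring |]. rewrite E. ring. }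
  rewrite E'.
  assert (Em1 : expi (zc (m - n1) * T)
    = expi (zc m * T + a) * expi (zc (-1) * a + zc n1 * zc (-1) * T)).
  { rewrite <- E. simpl. rewrite zc_0.
    replace (0 * a + zc n1 * 0 * T) with (RtoC 0) by ring. rewrite expi_0. ring. }
  assert (E0 : expi (zc 0 * a + zc n1 * zc 0 * T) = 1).
  { rewrite zc_0. replace (0 * a + zc n1 * 0 * T) with (RtoC 0) by ring. apply expi_0. }
  unfold chi_off.
  destruct (Z.eqb_spec n2 0) as [->|]; [|destruct (Z.eqb_spec n2 (-1)) as [->|]].
  - destruct (Z.leb_spec N n1), (Z.ltb_spec n1 N); simpl; try lia; rewrite ?E0; ring.
  - rewrite Em1. destruct (Z.leb_spec N n1), (Z.ltb_spec n1 N); simpl; try lia; ring.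
  - destruct (Z.leb_spec N n1), (Z.leb_spec 1 n2), (Z.ltb_spec n1 N), (Z.leb_spec n2 (-1)),
      (Z.leb_spec 1 (n2 + 1)), (Z.leb_spec (n2 + 1) (-1)); simpl; try lia; ring.
Qed.

(** The coefficient of [z^m] in Theta(z) times the whole series: the row [n2 = 0] contributes
    [z^N D(z)]. Adding it absorbs both boundary terms of the recursion for [prod_coef]. *)
Definition full_coef (m : Z) : C := theta_psum T (m - N) + prod_coef m.

Lemma full_coef_succ (m : Z) : full_coef (m + 1) = - expi (zc m * T + a) * full_coef m.
Proof. unfold full_coef. rewrite prod_coef_succ. ring. Qed.

(** Both sides obey the same first-order recursion, whose factor is a nonzero exponential, so it can
    be run upwards and downwards from 0. *)
Lemma full_coef_eq (m : Z) :
  full_coef m = full_coef 0 * (theta_coef T m * expi (zc m * a)).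
Proof.
  assert (S : forall k, theta_coef T (k + 1) * expi (zc (k + 1) * a) =
     - expi (zc k * T + a) * (theta_coef T k * expi (zc k * a))).
  { intros k. rewrite theta_coef_succ, zc_add, zc_1, Cmult_plus_distr_r, !expi_plus.
    replace (1 * a) with a by ring. ring. }
  induction m as [|m IH|m IH] using Z.peano_ind.
  - rewrite theta_coef_0, zc_0. replace (0 * a) with (RtoC 0) by ring. rewrite expi_0. ring.
  - unfold Z.succ. rewrite full_coef_succ, S, IH. ring.
  - rewrite <- Z.sub_1_r. replace m with (m - 1 + 1)%Z in IH by ring.
    rewrite full_coef_succ, S in IH.
    pose proof (expi_neq_0 (zc (m - 1) * T + a)) as NZ.
    set (e := expi (zc (m - 1) * T + a)) in *.
    transitivity (/ - e * (- e * full_coef (m - 1))); [field; auto |].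
    rewrite IH. field. auto.
Qed.

(** The row [n2 = 0] enters only through its product with Theta, so the identity includes real [b],
    where that row itself does not converge. *)
Lemma kronecker_laurent (b : C) : (Rabs (Im b) < Im T)%R ->
  expi (zc N * b) * jtheta_red T b + jtheta T b * off_sum b
  = full_coef 0 * jtheta T (a + b).
Proof.
  intros Hb. apply (has_sum_unique (fun m => full_coef m * expi (zc m * b))).
  - eapply has_sum_ext; [|apply has_sum_plus; [apply has_sum_scal,
      (has_sum_shift _ (- N) _ (laurent_has_sum _ b (theta_psum_fast T HT))) |
      apply theta_off_product, Hb]].
    intros m. simpl. unfold full_coef.
    replace (zc m * b) with (zc N * b + zc (m + - N) * b) by (zpush; ring).
    rewrite expi_plus. unfold Z.sub. ring.
  - eapply has_sum_ext; [|apply has_sum_scal,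
      (laurent_has_sum _ (a + b) (theta_coef_fast T HT))].
    intros m. simpl. rewrite (full_coef_eq m), Cmult_plus_distr_l, expi_plus. ring.
Qed.

Definition kappa : C := jtheta_red T 0.

Lemma jtheta_0 : jtheta T 0 = 0.
Proof.
  rewrite jtheta_factor by exact HT. rewrite expi_0. ring.
Qed.

Lemma kappa_eq : kappa = full_coef 0 * jtheta T a.
Proof.
  assert (H0 : (Rabs (Im 0) < Im T)%R) by (simpl; rewrite Rabs_R0; exact HT).
  pose proof (kronecker_laurent 0 H0) as K.
  replace (a + 0) with a in K by ring. rewrite <- K, jtheta_0.
  replace (zc N * 0) with (RtoC 0) by ring. rewrite expi_0. unfold kappa. ring.
Qed.

End Lattice.

(** For the derivative series: [|k| <= exp |k|] costs one unit of the rate. *)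
Lemma fast_zc_mult (c : Z -> C) : fast c -> fast (fun k => zc k * c k).
Proof.
  intros Hc rho. destruct (Hc (rho + 1)%R) as (M & HM & Hk).
  exists M. split; auto. intros k. rewrite Cmod_mult. unfold zc. rewrite Cmod_R.
  apply Rle_trans with (exp (Rabs (IZR k)) * (M * exp (- ((rho + 1) * Rabs (IZR k)))))%R.
  - apply Rmult_le_compat; auto using Rabs_pos, Cmod_ge_0.
    pose proof (exp_ineq1_le (Rabs (IZR k))). lra.
  - rewrite (Rmult_comm (exp _)), Rmult_assoc, <- exp_plus. apply Req_le. do 2 f_equal. ring.
Qed.

Lemma eventually_shift (P : nat -> Prop) :
  eventually (fun n => P (S n)) -> eventually P.
Proof.
  intros [n0 H]. exists (S n0). intros [|n] Hn; [lia | apply H; lia].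
Qed.

(** * Jacobi's identity for the cube of the q-Pochhammer symbol *)

Section Product.

Variable T : C.
Hypothesis HT : (0 < Im T)%R.

Let r : R := exp (- (2 * PI * Im T)).

Lemma nome_lt_1 : (0 < r < 1)%R.
Proof.
  unfold r. split; [apply exp_pos |]. rewrite <- exp_0. apply exp_increasing.
  pose proof PI_RGT_0. nra.
Qed.

Lemma Cmod_nome_pow (n : nat) : Cmod (expi (zc (Z.of_nat n) * T)) = (r ^ n)%R.
Proof.
  rewrite Cmod_expi, Im_zc_mult, <- INR_IZR_INZ. unfold r. rewrite <- exp_pow.
  f_equal. ring.
Qed.

Lemma nome_pow_le (n : nat) : (r ^ S n <= r)%R.
Proof.
  pose proof nome_lt_1. simpl. assert (0 <= r ^ n <= 1)%R; [|nra].
  split; [apply pow_le; lra |]. rewrite <- (pow1 n). apply pow_incr. lra.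
Qed.

Lemma Cmod_one_minus_nome_pow (n : nat) :
  (1 - r ^ S n <= Cmod (1 - expi (zc (Z.of_nat (S n)) * T)) <= 1 + r ^ S n)%R.
Proof.
  rewrite <- Cmod_nome_pow. set (x := expi _). split.
  - assert (1 <= Cmod (1 - x) + Cmod x)%R; [|lra].
    rewrite <- Cmod_1 at 1. replace (RtoC 1) with ((1 - x) + x) at 1 by ring.
    apply Cmod_triangle.
  - unfold Cminus. eapply Rle_trans; [apply Cmod_triangle |].
    rewrite Cmod_1, Cmod_opp. lra.
Qed.

Lemma one_minus_nome_pow_neq_0 (n : nat) : 1 - expi (zc (Z.of_nat (S n)) * T) <> 0.
Proof.
  apply Cmod_gt_0. pose proof (Cmod_one_minus_nome_pow n). pose proof (nome_pow_le n).
  pose proof nome_lt_1. lra.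
Qed.

(** Spelled as the partial products inside [Cprod_from1], so that its limit is literally the product
    occurring in [eta]. *)
Definition qpoch (n : nat) : C :=
  fold_right Cmult 1 (map (fun n => 1 - epow T (INR n)) (seq 1 n)).

Lemma qpoch_succ (n : nat) :
  qpoch (S n) = qpoch n * (1 - expi (zc (Z.of_nat (S n)) * T)).
Proof.
  unfold qpoch. rewrite seq_S, map_app.
  assert (E : forall (s : list C) x, fold_right Cmult 1 (s ++ x :: nil)
    = fold_right Cmult 1 s * x).
  { induction s as [|y s IH]; intros x; simpl; [ring | rewrite IH; ring]. }
  simpl map. rewrite E, epow_expi. unfold zc. now rewrite <- INR_IZR_INZ.
Qed.

Lemma qpoch_neq_0 (n : nat) : qpoch n <> 0.
Proof.
  induction n as [|n IH]; [apply C1_nz |].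
  rewrite qpoch_succ. apply Cmult_neq_0; auto using one_minus_nome_pow_neq_0.
Qed.

(** The exponents add up to [c] times a geometric sum. The form with one step ratio fits the
    products and their reciprocals alike. *)
Lemma product_bound (u : nat -> C) (c : R) : (0 <= c)%R ->
  u O = 1 -> (forall n, (Cmod (u (S n)) <= Cmod (u n) * exp (c * r ^ S n))%R) ->
  forall n, (Cmod (u n) <= exp (c * (r / (1 - r))))%R.
Proof.
  intros Hc H0 HS n. pose proof nome_lt_1 as Hr.
  assert (G : (Cmod (u n) <= exp (c * ((r - r ^ S n) / (1 - r))))%R).
  { induction n as [|n IH].
    - rewrite H0, Cmod_1. replace (c * _)%R with 0%R by (simpl; field; lra).
      rewrite exp_0. lra.
    - eapply Rle_trans; [apply HS |].
      eapply Rle_trans; [apply Rmult_le_compat_r; [left; apply exp_pos | apply IH] |].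
      rewrite <- exp_plus. apply Req_le. f_equal. simpl. field. lra. }
  eapply Rle_trans; [exact G |]. apply exp_le_compat.
  apply Rmult_le_compat_l; auto. apply Rmult_le_compat_r.
  - left. apply Rinv_0_lt_compat. lra.
  - assert (0 <= r ^ S n)%R by (apply pow_le; lra). lra.
Qed.

Lemma qpoch_bounds : exists M, (0 <= M)%R /\
  forall n, (Cmod (qpoch n) <= M)%R /\ (Cmod (/ qpoch n) <= M)%R.
Proof.
  pose proof nome_lt_1 as Hr.
  assert (P : (0 < / (1 - r))%R) by (apply Rinv_0_lt_compat; lra).
  exists (exp (1 * (r / (1 - r))) + exp (/ (1 - r) * (r / (1 - r))))%R.
  pose proof (exp_pos (1 * (r / (1 - r)))) as E1.
  pose proof (exp_pos (/ (1 - r) * (r / (1 - r)))) as E2.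
  split; [lra |].
  intros n. split.
  - enough (Cmod (qpoch n) <= exp (1 * (r / (1 - r))))%R by lra.
    apply product_bound; [lra | reflexivity |]. intros m.
    rewrite qpoch_succ, Cmod_mult. apply Rmult_le_compat_l; [apply Cmod_ge_0 |].
    pose proof (Cmod_one_minus_nome_pow m). pose proof (exp_ineq1_le (1 * r ^ S m)). lra.
  - enough (Cmod (/ qpoch n) <= exp (/ (1 - r) * (r / (1 - r))))%R by lra.
    apply (product_bound (fun n => / qpoch n)); [lra | |].
    { unfold qpoch; simpl. field. }
    intros m. pose proof (one_minus_nome_pow_neq_0 m) as NZ.
    pose proof (qpoch_neq_0 m) as NZ'.
    rewrite qpoch_succ.
    replace (/ (qpoch m * (1 - expi (zc (Z.of_nat (S m)) * T))))
      with (/ qpoch m * / (1 - expi (zc (Z.of_nat (S m)) * T))) by (field; auto).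
    rewrite Cmod_mult. apply Rmult_le_compat_l; [apply Cmod_ge_0 |].
    rewrite Cmod_inv by auto.
    pose proof (Cmod_one_minus_nome_pow m) as B. pose proof (nome_pow_le m) as B'.
    assert (PX : (0 <= r ^ S m)%R) by (apply pow_le; lra).
    eapply Rle_trans; [|apply exp_ineq1_le].
    set (x := (r ^ S m)%R) in *.
    apply Rle_trans with (/ (1 - x))%R.
    + apply Rinv_le_contravar; lra.
    (* Here [1 / (1 - x) = 1 + x / (1 - x)], and [x <= r] gives the constant [c = 1 / (1 - r)]. *)
    + replace (/ (1 - x))%R with (1 + / (1 - x) * x)%R by (field; lra).
      apply Rplus_le_compat_l, Rmult_le_compat_r; auto.
      apply Rinv_le_contravar; lra.
Qed.

Lemma qpoch_cv : exists L : C, L <> 0 /\ tends_to eventually qpoch L.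
Proof.
  destruct qpoch_bounds as (M & HM & HB). pose proof nome_lt_1 as Hr.
  set (u := fun n => qpoch n * expi (zc (Z.of_nat (S n)) * T)).
  assert (E : ex_series (V := C_NormedModule) u).
  { apply (ex_series_le (V := C_CompleteNormedModule) u (fun n => (M * r) * r ^ n)%R).
    - intros n. change (norm (u n)) with (Cmod (u n)). unfold u.
      rewrite Cmod_mult, Cmod_nome_pow. simpl.
      rewrite Rmult_assoc. apply Rmult_le_compat_r; [|apply HB].
      apply Rmult_le_pos; [lra | apply pow_le; lra].
    - apply (ex_series_scal (V := R_NormedModule) (M * r)%R).
      apply ex_series_geom. rewrite Rabs_pos_eq; lra. }
  destruct E as [l Hl]. exists (1 - l).
  (* Telescoping turns the product into a series whose terms are bounded by [M r^(n+1)]. *)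
  assert (HS : forall n, qpoch (S n) = 1 + - (1) * sum_n u n).
  { induction n as [|n IH].
    - rewrite sum_O, qpoch_succ. unfold u, qpoch. simpl map. simpl fold_right. ring.
    - rewrite sum_Sn, qpoch_succ. change (u (S n)) with
        (qpoch (S n) * expi (zc (Z.of_nat (S (S n))) * T)).
      rewrite IH. change plus with Cplus. ring. }
  assert (HL : tends_to eventually qpoch (1 - l)).
  { assert (H1 : tends_to eventually (fun n => qpoch (S n)) (1 + - (1) * l)).
    { apply (tends_to_ext eventually (fun n => 1 + - (1) * sum_n u n)).
      { apply filter_forall. intros n. now rewrite HS. }
      apply (tends_to_plus eventually (fun _ => RtoC 1) (fun n => - (1) * sum_n u n)).
      { apply (tends_to_const eventually). }
      apply (tends_to_mult eventually (fun _ => - (1)) (sum_n u)).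
      { apply (tends_to_const eventually). }
      apply (tends_to_filterlim eventually). exact Hl. }
    intros eps He. apply eventually_shift.
    replace (1 - l) with (1 + - (1) * l) by ring. now apply H1. }
  (* With limit zero, some [Cmod (qpoch n0)] would be below [1 / (M + 1)], against the bound [M] on
     the reciprocals. *)
  split; auto. intros E0. rewrite E0 in HL.
  assert (He : (0 < / (M + 1))%R) by (apply Rinv_0_lt_compat; lra).
  destruct (HL _ He) as [n0 Hn]. specialize (Hn n0 (le_n _)).
  replace (qpoch n0 - 0) with (qpoch n0) in Hn by ring.
  destruct (HB n0) as [_ H2]. rewrite Cmod_inv in H2 by apply qpoch_neq_0.
  assert (P : (0 < Cmod (qpoch n0))%R) by (apply Cmod_gt_0, qpoch_neq_0).
  apply Rinv_lt_contravar in Hn; [|apply Rmult_lt_0_compat; auto].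
  rewrite Rinv_inv in Hn. lra.
Qed.

(* The reciprocal q-Pochhammer symbol 1/(q;q)_n, which vanishes for n < 0. *)
Definition qpoch_inv (n : Z) : C :=
  if (0 <=? n)%Z then / qpoch (Z.to_nat n) else 0.

(** At [n = 0] the factor [1 - q^0] vanishes in accordance with the value 0 at [-1], so the
    recursion holds on all of [Z] with no boundary case. *)
Lemma qpoch_inv_pred (n : Z) :
  qpoch_inv (n - 1) = (1 - expi (zc n * T)) * qpoch_inv n.
Proof.
  unfold qpoch_inv. destruct (Z.leb_spec 0 n), (Z.leb_spec 0 (n - 1)); try lia.
  - assert (E : n = Z.of_nat (S (Z.to_nat (n - 1)))) by lia.
    set (m := Z.to_nat (n - 1)) in *. rewrite E, Nat2Z.id, qpoch_succ.
    field. auto using qpoch_neq_0, one_minus_nome_pow_neq_0.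
  - replace n with 0%Z by lia. rewrite zc_0.
    replace (0 * T) with (RtoC 0) by ring. rewrite expi_0. ring.
  - ring.
Qed.

(* By the finite form of the Jacobi triple product, these are the coefficients of
   [prod_(i < N) (1 - z q^i) (1 - q^(i+1) / z)]. *)
Definition finite_coef (N : nat) (k : Z) : C :=
  theta_coef T k * qpoch (2 * N) * qpoch_inv (Z.of_nat N + k) * qpoch_inv (Z.of_nat N - k).

(** Multiplication by the next factor [(1 - X z) (1 - q X / z) = 1 + q X^2 - X z - q X / z], read
    off at [z^k]. *)
Lemma finite_coef_succ (N : nat) (k : Z) :
  let X := expi (zc (Z.of_nat N) * T) in
  let q := expi T in
  finite_coef (S N) k = (1 + q * X * X) * finite_coef N k
    - X * finite_coef N (k - 1) - q * X * finite_coef N (k + 1).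
Proof.
  intros X q. unfold finite_coef.
  replace (2 * S N)%nat with (S (S (2 * N)))%nat by lia.
  rewrite !qpoch_succ, theta_coef_succ.
  pose proof (theta_coef_succ T (k - 1)) as Et. rewrite Z.sub_add in Et. rewrite Et. clear Et.
  set (t := theta_coef T (k - 1)). set (P := expi (zc (k - 1) * T)).
  assert (EP : expi (zc k * T) = q * P).
  { unfold q, P. rewrite <- expi_plus. f_equal. zpush. ring. }
  set (n := Z.of_nat N).
  replace (Z.of_nat (S N)) with (n + 1)%Z by lia.
  replace (n + k)%Z with ((n + 1 + k) - 1)%Z by ring.
  replace (n - k)%Z with ((n + 1 - k) - 1)%Z by ring.
  replace (n + (k - 1))%Z with ((n + 1 + k) - 1 - 1)%Z by ring.
  replace (n - (k - 1))%Z with (n + 1 - k)%Z by ring.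
  replace (n + (k + 1))%Z with (n + 1 + k)%Z by ring.
  replace (n - (k + 1))%Z with ((n + 1 - k) - 1 - 1)%Z by ring.
  (* All reciprocal symbols are expressed through the two of largest index, [B] and [D]; what
     remains is a rational identity in [q], [X] and [P]. *)
  rewrite !qpoch_inv_pred.
  set (B := qpoch_inv (n + 1 + k)). set (D := qpoch_inv (n + 1 - k)).
  replace (zc (n + 1 + k) * T) with (zc n * T + T + zc k * T) by (zpush; ring).
  replace (zc (n + 1 - k) * T) with (zc n * T + T + - (zc k * T)) by (zpush; ring).
  replace (zc (n + 1 + k - 1) * T) with (zc n * T + zc k * T) by (zpush; ring).
  replace (zc (n + 1 - k - 1) * T) with (zc n * T + - (zc k * T)) by (zpush; ring).
  replace (zc (Z.of_nat (S (2 * N))) * T) with (zc n * T + zc n * T + T).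
  2:{ replace (Z.of_nat (S (2 * N))) with (n + n + 1)%Z by lia. zpush. ring. }
  replace (zc (Z.of_nat (S (S (2 * N)))) * T) with (zc n * T + zc n * T + T + T).
  2:{ replace (Z.of_nat (S (S (2 * N)))) with (n + n + 1 + 1)%Z by lia. zpush. ring. }
  rewrite !expi_plus, expi_opp, EP. fold X. fold q. change (expi (zc n * T)) with X.
  assert (NP : P <> 0) by apply expi_neq_0. assert (Nq : q <> 0) by apply expi_neq_0.
  field. auto.
Qed.

Lemma finite_coef_bound : exists M, (0 <= M)%R /\
  forall N k, (Cmod (finite_coef N k) <= M * Cmod (theta_coef T k))%R.
Proof.
  destruct qpoch_bounds as (M & HM & HB).
  assert (HI : forall n, (Cmod (qpoch_inv n) <= M)%R).
  { intros n. unfold qpoch_inv. destruct (Z.leb_spec 0 n); [apply HB | now rewrite Cmod_0]. }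
  exists (M * M * M)%R. split; [now repeat apply Rmult_le_pos |].
  intros N k. unfold finite_coef. rewrite !Cmod_mult.
  replace (M * M * M * Cmod (theta_coef T k))%R
    with (Cmod (theta_coef T k) * M * M * M)%R by ring.
  repeat apply Rmult_le_compat; auto using Cmod_ge_0, Rle_refl;
    try (repeat apply Rmult_le_pos; auto using Cmod_ge_0); apply HB.
Qed.

(** [A] and [B] are the value and the derivative [z d/dz] at [z = 1] of the finite product. This is
    the product rule for the next factor, with value [(1 - X) (1 - q X)] and derivative
    [- X + q X]. *)
Lemma finite_coef_sums_succ (N : nat) (A B : C) :
  let X := expi (zc (Z.of_nat N) * T) in
  let q := expi T in
  has_sum (finite_coef N) A -> has_sum (fun k => zc k * finite_coef N k) B ->
  has_sum (finite_coef (S N)) ((1 - X) * (1 - q * X) * A) /\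
  has_sum (fun k => zc k * finite_coef (S N) k)
    ((1 - X) * (1 - q * X) * B - X * (1 - q) * A).
Proof.
  intros X q HA HB. split.
  - replace ((1 - X) * (1 - q * X) * A)
      with ((1 + q * X * X) * A + (- X * A + - (q * X) * A)) by ring.
    eapply has_sum_ext; [|apply has_sum_plus; [apply has_sum_scal, HA |
      apply has_sum_plus; [apply has_sum_scal, (has_sum_shift _ (-1) _ HA) |
        apply has_sum_scal, (has_sum_shift _ 1 _ HA)]]].
    intros k. simpl. rewrite finite_coef_succ. unfold Z.sub. fold X. fold q.
    change (- (1))%Z with (-1)%Z. ring.
  - replace ((1 - X) * (1 - q * X) * B - X * (1 - q) * A)
      with ((1 + q * X * X) * B +
            (- X * (B + A) + - (q * X) * (B + - (1) * A))) by ring.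
    pose proof (has_sum_plus _ _ _ _ HB HA) as H1.
    pose proof (has_sum_plus _ _ _ _ HB (has_sum_scal (- (1)) _ _ HA)) as H2.
    eapply has_sum_ext; [|apply has_sum_plus; [apply has_sum_scal, HB |
      apply has_sum_plus; [apply has_sum_scal, (has_sum_shift _ (-1) _ H1) |
        apply has_sum_scal, (has_sum_shift _ 1 _ H2)]]].
    intros k. simpl. rewrite finite_coef_succ. fold X. fold q.
    change (k + -1)%Z with (k - 1)%Z. rewrite zc_sub, zc_add, zc_1. ring.
Qed.

Lemma finite_coef_0_sums :
  has_sum (finite_coef 0) 1 /\ has_sum (fun k => zc k * finite_coef 0 k) 0.
Proof.
  assert (E : forall k, k <> 0%Z -> finite_coef 0 k = 0).
  { intros k Hk. unfold finite_coef, qpoch_inv. simpl Z.of_nat.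
    destruct (Z.leb_spec 0 (0 + k)), (Z.leb_spec 0 (0 - k)); try lia; ring. }
  split; apply (has_sum_single 0%Z).
  - unfold finite_coef. rewrite theta_coef_0. unfold qpoch_inv, qpoch. simpl. field.
  - exact E.
  - rewrite zc_0. ring.
  - intros k Hk. rewrite E by exact Hk. ring.
Qed.

(** The first factor contains [1 - z], so the value is zero from then on and the derivative starts
    at [- (1 - q)]. Each later step just multiplies the derivative by the value of the new
    factor. *)
Lemma finite_coef_sums (N : nat) :
  has_sum (finite_coef (S N)) 0 /\
  has_sum (fun k => zc k * finite_coef (S N) k) (- (qpoch N * qpoch (S N))).
Proof.
  induction N as [|N [IH1 IH2]].
  - destruct finite_coef_0_sums as [H1 H2].
    destruct (finite_coef_sums_succ 0 _ _ H1 H2) as [H3 H4].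
    simpl Z.of_nat in H3, H4. rewrite zc_0 in H3, H4.
    replace (0 * T) with (RtoC 0) in H3, H4 by ring. rewrite expi_0 in H3, H4.
    split.
    + replace (RtoC 0) with ((1 - 1) * (1 - expi T * 1) * 1) by ring. exact H3.
    + rewrite qpoch_succ. unfold qpoch at 1 2. simpl. rewrite zc_1.
      replace (1 * T) with T by ring.
      match type of H4 with has_sum _ ?v => replace (- _) with v by ring end.
      exact H4.
  - destruct (finite_coef_sums_succ (S N) _ _ IH1 IH2) as [H3 H4]. split.
    + match type of H3 with has_sum _ ?v => replace (RtoC 0) with v by ring end.
      exact H3.
    + rewrite (qpoch_succ (S N)), (qpoch_succ N) at 1.
      match type of H4 with has_sum _ ?v => replace (- _) with v end.
      { exact H4. }
      assert (E : expi T * expi (zc (Z.of_nat (S N)) * T) = expi (zc (Z.of_nat (S (S N))) * T)).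
      { rewrite <- expi_plus. f_equal.
        replace (Z.of_nat (S (S N))) with (Z.of_nat (S N) + 1)%Z by lia. zpush. ring. }
      rewrite E. ring.
Qed.

Lemma qpoch_inv_tends_to (L : C) (j : nat -> Z) :
  L <> 0 -> tends_to eventually qpoch L ->
  (forall m : nat, eventually (fun n => (Z.of_nat m <= j n)%Z)) ->
  tends_to eventually (fun n => qpoch_inv (j n)) (/ L).
Proof.
  intros NL HL Hj eps He.
  destruct (tends_to_inv eventually _ _ NL HL eps He) as [n0 H0].
  apply (filter_imp (fun n => (Z.of_nat n0 <= j n)%Z)); [|apply Hj].
  intros n Hn. unfold qpoch_inv. destruct (Z.leb_spec 0 (j n)); [|lia].
  apply H0. lia.
Qed.

Lemma finite_coef_tends_to (L : C) (k : Z) :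
  L <> 0 -> tends_to eventually qpoch L ->
  tends_to eventually (fun N => zc k * finite_coef (S N) k) (/ L * (zc k * theta_coef T k)).
Proof.
  intros NL HL.
  assert (H2 : tends_to eventually (fun N => qpoch (2 * S N)) L).
  { intros eps He. destruct (HL eps He) as [n0 H0]. exists n0. intros n Hn.
    apply H0. lia. }
  replace (/ L * (zc k * theta_coef T k)) with ((zc k * theta_coef T k) * L * / L * / L)
    by (field; auto).
  apply (tends_to_ext eventually (fun N => (zc k * theta_coef T k) * qpoch (2 * S N) *
    qpoch_inv (Z.of_nat (S N) + k) * qpoch_inv (Z.of_nat (S N) - k))).
  { apply filter_forall. intros N. unfold finite_coef. ring. }
  apply (tends_to_mult eventually); [apply (tends_to_mult eventually);
    [apply (tends_to_mult eventually); [apply (tends_to_const eventually) | exact H2] |] |].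
  - apply qpoch_inv_tends_to; auto. intros m. exists (m + Z.abs_nat k)%nat.
    intros n Hn. lia.
  - apply qpoch_inv_tends_to; auto. intros m. exists (m + Z.abs_nat k)%nat.
    intros n Hn. lia.
Qed.

(** The coefficients of the finite product tend to [t_k / L], dominated uniformly in [N], while the
    derivatives [- qpoch N * qpoch (S N)] tend to [- L^2]. Comparing the two limits gives
    [- L^3]. *)
Lemma derivative_sum (L : C) : L <> 0 -> tends_to eventually qpoch L ->
  has_sum (fun k => zc k * theta_coef T k) (- (L * L * L)).
Proof.
  intros NL HL.
  pose proof (laurent_0 _ (fast_zc_mult _ (theta_coef_fast T HT))) as H.
  set (s := laurent _ 0) in H.
  enough (E : - (L * L) = / L * s).
  { replace (- (L * L * L)) with (L * - (L * L)) by ring. rewrite E.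
    replace (L * (/ L * s)) with s by (field; auto). exact H. }
  apply (tends_to_unique eventually (fun N => - (1) * (qpoch N * qpoch (S N)))).
  - replace (- (L * L)) with (- (1) * (L * L)) by ring.
    apply (tends_to_mult eventually (fun _ => - (1))); [apply (tends_to_const eventually) |].
    apply (tends_to_mult eventually qpoch (fun n => qpoch (S n))); auto.
    intros eps He. destruct (HL eps He) as [n0 H0]. exists n0. intros n Hn. apply H0. lia.
  - destruct finite_coef_bound as (M & HM & HB).
    apply (dominated_convergence eventually
      (fun N k => zc k * finite_coef (S N) k) (fun k => / L * (zc k * theta_coef T k)) _ _
      (fun k => (M + Cmod (/ L)) * Cmod (zc k * theta_coef T k))%R).
    + apply summable_scal; [pose proof (Cmod_ge_0 (/ L)); lra |].
      generalize (fast_summable _ 0 (fast_zc_mult _ (theta_coef_fast T HT))).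
      apply summable_le. intros k. replace (zc k * 0) with (RtoC 0) by ring.
      rewrite expi_0, Cmult_1_r. apply Rle_refl.
    + apply filter_forall. intros N k. rewrite !Cmod_mult.
      pose proof (HB (S N) k). pose proof (Cmod_ge_0 (zc k)). pose proof (Cmod_ge_0 (/ L)).
      pose proof (Cmod_ge_0 (theta_coef T k)).
      apply Rle_trans with (Cmod (zc k) * (M * Cmod (theta_coef T k)))%R.
      * now apply Rmult_le_compat_l.
      * assert (0 <= Cmod (/ L) * (Cmod (zc k) * Cmod (theta_coef T k)))%R
          by (repeat apply Rmult_le_pos; auto). lra.
    + intros k. rewrite Cmod_mult. apply Rmult_le_compat_r; [apply Cmod_ge_0 |].
      lra.
    + intros k. now apply finite_coef_tends_to.
    + apply filter_forall. intros N.
      replace (- (1) * (qpoch N * qpoch (S N))) with (- (qpoch N * qpoch (S N))) by ring.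
      apply finite_coef_sums.
    + now apply has_sum_scal.
Qed.

Lemma kappa_cube : exists L : C, L <> 0 /\ tends_to eventually qpoch L /\ kappa T = L * L * L.
Proof.
  destruct qpoch_cv as (L & NL & HL). exists L. repeat split; auto.
  pose proof (laurent_0 _ (theta_psum_fast T HT)) as Hk. fold (jtheta_red T 0) in Hk.
  fold (kappa T) in Hk.
  pose proof (laurent_0 _ (fast_zc_mult _ (theta_psum_fast T HT))) as Hz.
  set (w := laurent _ 0) in Hz.
  pose proof (derivative_sum L NL HL) as HD.
  (* Summation by parts: [k c_k - (k-1) c_(k-1) = k t_k + c_(k-1)], and the left side sums to zero
     by a shift. *)
  assert (E : w + - (1) * w = - (L * L * L) + kappa T).
  { apply (has_sum_unique (fun k => zc k * theta_coef T k + theta_psum T (k + -1))).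
    - eapply has_sum_ext; [|apply has_sum_plus; [exact Hz |
        apply has_sum_scal, (has_sum_shift _ (-1) _ Hz)]].
      intros k. simpl. rewrite (theta_psum_pred T HT k). change (k + -1)%Z with (k - 1)%Z.
      rewrite zc_sub, zc_1. ring.
    - apply has_sum_plus; [exact HD | exact (has_sum_shift _ (-1) _ Hk)]. }
  replace (kappa T) with (L * L * L + (- (L * L * L) + kappa T)) by ring.
  rewrite <- E. ring.
Qed.

Lemma kappa_neq_0 : kappa T <> 0.
Proof.
  destruct kappa_cube as (L & NL & _ & ->). now repeat apply Cmult_neq_0.
Qed.

(** * Eta and theta in terms of kappa and Theta *)

Lemma eta_cube : eta T ^ 3 = expi (T / 8) * kappa T.
Proof.
  destruct kappa_cube as (L & NL & HL & ->).
  unfold eta. replace (Cprod_from1 (fun n => 1 - epow T (INR n))) with L.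
  - rewrite epow_expi.
    replace (T / 8) with (RtoC (1 / 24) * T + RtoC (1 / 24) * T + RtoC (1 / 24) * T).
    + rewrite !expi_plus. ring.
    + rewrite RtoC_div by lra. field.
  - symmetry. unfold Cprod_from1, Clim.
    apply (@iota_filterlim_locally C_AbsRing C_CompleteNormedModule).
    + apply Proper_StrongProper, eventually_filter.
    + now apply (tends_to_filterlim eventually).
Qed.

(** With [n = j - 1/2] one has [n^2 / 2 = j (j - 1) / 2 + 1/8] and
    [n (z + 1/2) = j z + j / 2 - z / 2 - 1/4]; the parts without [j] form the prefactor. *)
Lemma theta_jtheta (z : C) :
  theta z T = expi (T / 8 - z / 2 - 1 / 4) * jtheta T z.
Proof.
  apply Csum_eq.
  pose proof (has_sum_scal (expi (T / 8 - z / 2 - 1 / 4)) _ _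
    (laurent_has_sum _ z (theta_coef_fast T HT))) as H.
  apply (has_sum_shift _ 1) in H. revert H. apply has_sum_ext.
  intros k. cbv zeta. rewrite !epow_expi. unfold theta_coef.
  rewrite <- !expi_plus. f_equal.
  replace (RtoC ((IZR k + 1 / 2) ^ 2 / 2)) with ((zc k + 1 / 2) * (zc k + 1 / 2) / 2).
  2:{ unfold zc. rewrite RtoC_div by lra. rewrite RtoC_pow, RtoC_plus, RtoC_div by lra. field. }
  replace (RtoC (IZR k + 1 / 2)) with (zc k + 1 / 2).
  2:{ unfold zc. now rewrite RtoC_plus, RtoC_div by lra. }
  replace (RtoC (1 / 2)) with (1 / 2) by (now rewrite RtoC_div by lra).
  rewrite zc_add, zc_1. field.
Qed.

End Product.

(** * The Kronecker series and its limits *)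

Lemma chi2_pos (x y : R) : (0 < x)%R -> (0 < y)%R -> chi2 x y = 1%R.
Proof.
  intros Hx Hy. unfold chi2, heaviside. rewrite sign_eq_1 by exact Hx.
  destruct (Rlt_dec 0 (x * y)) as [|H]; [lra | destruct H; nra].
Qed.

Lemma chi2_neg (x y : R) : (x < 0)%R -> (y < 0)%R -> chi2 x y = (-1)%R.
Proof.
  intros Hx Hy. unfold chi2, heaviside. rewrite sign_eq_m1 by exact Hx.
  destruct (Rlt_dec 0 (x * y)) as [|H]; [lra | destruct H; nra].
Qed.

Lemma chi2_opposite (x y : R) : (x * y <= 0)%R -> chi2 x y = 0%R.
Proof.
  intros H. unfold chi2, heaviside. destruct (Rlt_dec 0 (x * y)); lra.
Qed.

Lemma RtoC_neq_0 (x : R) : x <> 0%R -> RtoC x <> 0.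
Proof. intros H E. now apply H, RtoC_inj. Qed.

Lemma expi_neq_1 (b : C) : Im b <> 0%R -> 1 - expi b <> 0.
Proof.
  intros Hb E. assert (E1 : expi b = 1).
  { replace (expi b) with (1 - (1 - expi b)) by ring. rewrite E. ring. }
  apply (f_equal Cmod) in E1. rewrite Cmod_expi, Cmod_1, <- exp_0 in E1.
  apply exp_inv in E1. pose proof PI_RGT_0. apply Hb. nra.
Qed.

(** Shifting the index by one gives [s = e(b) s + e(N b)], which determines [s]. *)
Lemma geometric_right (b : C) (N : Z) : (0 < Im b)%R ->
  has_sum (fun n => if (N <=? n)%Z then expi (zc n * b) else 0)
          (expi (zc N * b) / (1 - expi b)).
Proof.
  intros Hb. set (g := fun n => if (N <=? n)%Z then expi (zc n * b) else 0).
  pose proof PI_RGT_0 as HPI.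
  assert (S : summable (fun n => Cmod (g n))).
  { eapply summable_le; [|apply (summable_scal (exp (2 * PI * Im b * (2 * Rabs (IZR N))))
      _ (Rlt_le _ _ (exp_pos _)) (summable_exp (2 * PI * Im b) ltac:(nra)))].
    intros n. unfold g. rewrite <- exp_plus. destruct (Z.leb_spec N n) as [H|H].
    - rewrite Cmod_expi, Im_zc_mult. apply exp_le_compat.
      (* Equality of [|n|] and [n] can fail only when [N] is negative; [2 |N|] covers this and
         explains the constant of the majorant. *)
      assert (Rabs (IZR n) <= IZR n + 2 * Rabs (IZR N))%R.
      { rewrite <- !abs_IZR, <- mult_IZR, <- plus_IZR. apply IZR_le. lia. }
      assert (0 < 2 * PI * Im b)%R by nra. nra.
    - rewrite Cmod_0. left. apply exp_pos. }
  pose proof (summable_has_sum g S) as H. set (s := Csum g) in *.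
  assert (E : s = expi b * s + expi (zc N * b)).
  { apply (has_sum_unique (fun n => g (n + 1)%Z)); [now apply has_sum_shift |].
    eapply has_sum_ext; [|apply has_sum_plus; [apply has_sum_scal, H |
      apply (has_sum_single (N - 1)%Z
        (fun n => if (n =? N - 1)%Z then expi (zc N * b) else 0));
      [now rewrite Z.eqb_refl |]]].
    - intros n. unfold g. simpl.
      replace (zc (n + 1) * b) with (b + zc n * b) by (zpush; ring). rewrite expi_plus.
      destruct (Z.leb_spec N (n + 1)), (Z.leb_spec N n), (Z.eqb_spec n (N - 1));
        try lia; subst; try ring.
      replace (zc N * b) with (b + zc (N - 1) * b) by (zpush; ring).
      rewrite expi_plus. ring.
    - intros n Hn. destruct (Z.eqb_spec n (N - 1)); tauto. }
  replace (expi (zc N * b) / (1 - expi b)) with s; [exact H |].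
  assert (NZ : 1 - expi b <> 0) by (apply expi_neq_1; lra).
  replace (expi (zc N * b)) with (s - expi b * s) by (rewrite E at 1; ring).
  field. exact NZ.
Qed.

(** The reflection [n -> - n] of the other case. The complementary half-line with the opposite sign
    sums to the same rational function, so a single formula serves both sides of the real line. *)
Lemma geometric_left (b : C) (N : Z) : (Im b < 0)%R ->
  has_sum (fun n => if (n <? N)%Z then - expi (zc n * b) else 0)
          (expi (zc N * b) / (1 - expi b)).
Proof.
  intros Hb.
  assert (Hb' : (0 < Im (- b))%R) by (destruct b; simpl in *; lra).
  pose proof (has_sum_bij (fun n => (- n)%Z) (fun n => (- n)%Z) _ _
    Z.opp_involutive Z.opp_involutive (geometric_right (- b) (1 - N) Hb')) as H.
  apply (has_sum_scal (- (1))) in H.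
  replace (expi (zc N * b) / (1 - expi b))
    with (- (1) * (expi (zc (1 - N) * - b) / (1 - expi (- b)))).
  - revert H. apply has_sum_ext. intros n.
    destruct (Z.leb_spec (1 - N) (- n)), (Z.ltb_spec n N); try lia; [|ring].
    replace (zc (- n) * - b) with (zc n * b) by (zpush; ring). ring.
  - assert (NZ : 1 - expi b <> 0) by (apply expi_neq_1; lra).
    pose proof (expi_neq_0 b) as NE.
    replace (zc (1 - N) * - b) with (zc N * b + - b) by (zpush; ring).
    rewrite expi_plus, expi_opp. field. repeat split; auto.
    intros E. apply NZ. replace (1 - expi b) with (- (expi b - 1)) by ring. rewrite E. ring.
Qed.

Lemma tends_to_exp_quotient (c : R) : c <> 0%R ->
  tends_to (at_right 0) (fun e => RtoC e / RtoC (1 - exp (- (c * e)))) (/ RtoC c).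
Proof.
  intros Hc.
  apply (tends_to_ext (at_right 0) (fun e => / RtoC ((1 - exp (- (c * e))) / e))).
  { apply (filter_imp (fun e => (0 < e < 1)%R)); [|apply at_right_lt; lra].
    intros e He. rewrite RtoC_div by lra.
    assert (N1 : RtoC e <> 0) by (apply RtoC_neq_0; lra).
    assert (N2 : RtoC (1 - exp (- (c * e))) <> 0).
    { apply RtoC_neq_0. intros E.
      assert (E' : exp (- (c * e)) = exp 0) by (rewrite exp_0; lra).
      apply exp_inv in E'. assert (c * e <> 0)%R by (apply Rmult_integral_contrapositive; lra).
      lra. }
    field. auto. }
  apply (tends_to_inv (at_right 0)).
  { now apply RtoC_neq_0. }
  intros eps He.
  assert (Hec : (0 < eps / Rabs c)%R) by (apply Rdiv_lt_0_compat; auto; now apply Rabs_pos_lt).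
  destruct (derivable_pt_lim_exp_0 _ Hec) as [d Hd].
  assert (Hdc : (0 < d / Rabs c)%R)
    by (apply Rdiv_lt_0_compat; [apply cond_pos | now apply Rabs_pos_lt]).
  apply (filter_imp (fun e => (0 < e < d / Rabs c)%R)); [|now apply at_right_lt].
  intros e Hed. rewrite <- RtoC_minus, Cmod_R.
  assert (Ac : (0 < Rabs c)%R) by now apply Rabs_pos_lt.
  assert (NZ : (- (c * e) <> 0)%R).
  { intros E. assert (c * e <> 0)%R by (apply Rmult_integral_contrapositive; lra). lra. }
  specialize (Hd (- (c * e))%R NZ).
  rewrite Rabs_Ropp, Rabs_mult, (Rabs_pos_eq e), Rplus_0_l, exp_0 in Hd by lra.
  assert (L : (Rabs c * e < d)%R).
  { replace (pos d) with (Rabs c * (d / Rabs c))%R by (field; lra).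
    apply Rmult_lt_compat_l; lra. }
  specialize (Hd L).
  replace ((1 - exp (- (c * e))) / e - c)%R
    with (c * ((exp (- (c * e)) - 1) / - (c * e) - 1))%R by (field; lra).
  rewrite Rabs_mult.
  replace eps with (Rabs c * (eps / Rabs c))%R by (field; lra).
  apply Rmult_lt_compat_l; auto.
Qed.

Section Kronecker.

Variable T : C.
Hypothesis HT : (0 < Im T)%R.

Lemma exists_floor (a : C) : (forall k : Z, Im a <> (IZR k * Im T)%R) ->
  exists N : Z, (0 < IZR N * Im T + Im a < Im T)%R.
Proof.
  intros Ha. destruct (archimed (- (Im a / Im T))) as [H1 H2].
  set (N := up (- (Im a / Im T))) in *. exists N.
  assert (Ea : Im a = (Im a / Im T * Im T)%R) by (field; lra).
  (* [up] only yields [N + Im a / Im T <= 1]; equality would place [a] on a lattice line, which is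
     excluded. *)
  assert (N1 : (IZR N + Im a / Im T <> 1)%R).
  { intros E. apply (Ha (1 - N)%Z). rewrite minus_IZR, Ea at 1.
    replace (Im a / Im T)%R with (1 - IZR N)%R by lra. reflexivity. }
  set (x := (Im a / Im T)%R) in *.
  assert (IZR N + x < 1)%R by (destruct (Rle_lt_or_eq_dec (IZR N + x) 1); lra).
  rewrite Ea. replace (IZR N * Im T + x * Im T)%R with ((IZR N + x) * Im T)%R by ring.
  split; nra.
Qed.

Lemma jtheta_neq_0 (a : C) : (forall k : Z, Im a <> (IZR k * Im T)%R) -> jtheta T a <> 0.
Proof.
  intros Ha E. destruct (exists_floor a Ha) as [N HN].
  apply (kappa_neq_0 T HT). rewrite (kappa_eq T a N HT HN), E. ring.
Qed.

(** A zero of D at [x] is a zero of Theta, so both terms on the left of [kronecker_laurent] vanish.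
    With the auxiliary [a = T / 2], halfway between lattice lines, neither factor on the right can
    be zero. *)
Lemma jtheta_red_real_neq_0 (x : R) : jtheta_red T (RtoC x) <> 0.
Proof.
  intros E. set (a := T / 2).
  assert (Ia : Im a = (Im T / 2)%R).
  { unfold a. replace (T / 2) with (RtoC (/ 2) * T).
    - rewrite im_scal_l. field.
    - rewrite RtoC_inv by lra. field. }
  assert (HN : (0 < IZR 0 * Im T + Im a < Im T)%R) by (rewrite Ia; lra).
  assert (Hx : (Rabs (Im (RtoC x)) < Im T)%R) by (simpl; rewrite Rabs_R0; exact HT).
  pose proof (kronecker_laurent T a 0 HT HN (RtoC x) Hx) as K.
  rewrite jtheta_factor, E in K by exact HT.
  apply (Cmult_neq_0 (full_coef T a 0 0) (jtheta T (a + RtoC x))).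
  - intros E0. apply (kappa_neq_0 T HT). rewrite (kappa_eq T a 0 HT HN), E0. ring.
  - apply jtheta_neq_0. intros k.
    replace (Im (a + RtoC x)) with (Im a) by (destruct a; simpl; ring).
    rewrite Ia. intros Ek. assert (Ek' : (IZR k = / 2)%R) by nra.
    assert (0 < k < 1)%Z; [|lia]. split; apply lt_IZR; lra.
  - rewrite <- K. ring.
Qed.

Definition lattice_term (a b : C) (p : Z * Z) : C :=
  RtoC (chi2 (IZR (fst p) + Im a / Im T) (IZR (snd p) + Im b / Im T)) *
  expi (zc (fst p) * zc (snd p) * T + zc (snd p) * a + zc (fst p) * b).

(** Since [|be| < 1], the sign of [n2 + be] is that of [n2] except in the row [n2 = 0]. There the
    sign of [be] selects one of the two half-rows, which have the same sum. *)
Lemma lattice_sum (a b : C) (N : Z) :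
  (0 < IZR N * Im T + Im a < Im T)%R -> (0 < Rabs (Im b) < Im T)%R ->
  has_sum (lattice_term a b) (expi (zc N * b) / (1 - expi b) + off_sum T a N b).
Proof.
  intros HN Hb.
  set (al := (Im a / Im T)%R). set (be := (Im b / Im T)%R).
  assert (Ea : Im a = (al * Im T)%R) by (unfold al; field; lra).
  assert (Eb : Im b = (be * Im T)%R) by (unfold be; field; lra).
  rewrite Ea in HN.
  assert (Hal : (0 < IZR N + al < 1)%R) by (split; nra).
  assert (Hbe : (0 < Rabs be < 1)%R).
  { rewrite Eb, Rabs_mult, (Rabs_pos_eq (Im T)) in Hb by lra. split; nra. }
  assert (P1 : forall n, (N <= n)%Z -> (0 < IZR n + al)%R)
    by (intros n Hn; apply IZR_le in Hn; lra).
  assert (P2 : forall n, (n < N)%Z -> (IZR n + al < 0)%R).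
  { intros n Hn. assert (Hn' : (n + 1 <= N)%Z) by lia. apply IZR_le in Hn'.
    rewrite plus_IZR in Hn'. lra. }
  assert (Hbe' : (-1 < be < 1)%R) by (destruct Hbe as [_ Q]; apply Rabs_def2 in Q; lra).
  assert (Q1 : forall n, (1 <= n)%Z -> (0 < IZR n + be)%R)
    by (intros n Hn; apply IZR_le in Hn; lra).
  assert (Q2 : forall n, (n <= -1)%Z -> (IZR n + be < 0)%R)
    by (intros n Hn; apply IZR_le in Hn; lra).
  assert (HR : has_sum (off_term T a N b) (off_sum T a N b)).
  { apply summable_has_sum, summable_off; auto; [rewrite Ea; exact HN | lra]. }
  assert (Hrow : exists g, has_sum g (expi (zc N * b) / (1 - expi b)) /\ forall n,
    RtoC (chi2 (IZR n + al) be) * expi (zc n * b) = g n).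
  { destruct (Rtotal_order 0 (Im b)) as [H|[H|H]].
    - eexists. split; [apply geometric_right, H |]. intros n. simpl.
      assert (0 < be)%R by nra.
      destruct (Z.leb_spec N n).
      + rewrite chi2_pos; auto. ring.
      + specialize (P2 n ltac:(lia)). rewrite chi2_opposite by nra. ring.
    - rewrite <- H, Rabs_R0 in Hb. lra.
    - eexists. split; [apply geometric_left, H |]. intros n. simpl.
      assert (be < 0)%R by nra.
      destruct (Z.ltb_spec n N).
      + rewrite chi2_neg by auto. change (RtoC (-1)) with (RtoC (- (1))).
        rewrite RtoC_opp. ring.
      + specialize (P1 n ltac:(lia)). rewrite chi2_opposite by nra. ring. }
  destruct Hrow as (g & Hg & Eg).
  eapply has_sum_ext; [|apply has_sum_plus; [exact (has_sum_row g 0 _ Hg) | exact HR]].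
  intros [n1 n2]. unfold lattice_term, off_term, chi_off. simpl. fold al be.
  destruct (Z.eqb_spec n2 0) as [->|Hn].
  - rewrite <- Eg, Rplus_0_l.
    replace (zc n1 * zc 0 * T + zc 0 * a + zc n1 * b) with (zc n1 * b)
      by (rewrite zc_0; ring).
    rewrite !andb_false_r. ring.
  - destruct (Z.leb_spec N n1), (Z.leb_spec 1 n2), (Z.ltb_spec n1 N), (Z.leb_spec n2 (-1));
      simpl; try lia.
    + rewrite chi2_pos by auto. ring.
    + specialize (P1 n1 ltac:(lia)). specialize (Q2 n2 ltac:(lia)).
      rewrite chi2_opposite by nra. ring.
    + specialize (P2 n1 ltac:(lia)). specialize (Q1 n2 ltac:(lia)).
      rewrite chi2_opposite by nra. ring.
    + rewrite chi2_neg by auto. change (RtoC (-1)) with (RtoC (- (1))).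
      rewrite RtoC_opp. ring.
Qed.

(** Replacing [n2] by [n2 + m] absorbs [m T] both in the exponent and in [chi2]; the leftover is
    [e(-m a)]. *)
Lemma lattice_sum_shift (a b : C) (m : Z) (l : C) :
  has_sum (lattice_term a b) l ->
  has_sum (lattice_term a (zc m * T + b)) (expi (- (zc m * a)) * l).
Proof.
  intros H.
  pose proof (has_sum_bij (fun p : Z * Z => (fst p, snd p + m)%Z)
    (fun p => (fst p, snd p - m)%Z) (lattice_term a b) l
    ltac:(intros [x y]; simpl; f_equal; lia) ltac:(intros [x y]; simpl; f_equal; lia) H) as H1.
  eapply has_sum_ext; [|apply has_sum_scal, H1].
  intros [n1 n2]. unfold lattice_term; cbn [fst snd].
  replace (Im (zc m * T + b) / Im T)%R with (IZR m + Im b / Im T)%R.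
  2:{ replace (Im (zc m * T + b)) with (IZR m * Im T + Im b)%R
        by (rewrite <- Im_zc_mult; destruct (zc m * T), b; reflexivity).
      field. lra. }
  rewrite plus_IZR, Rplus_assoc.
  set (c := RtoC _).
  transitivity (c * (expi (- (zc m * a)) *
    expi (zc n1 * zc (n2 + m) * T + zc (n2 + m) * a + zc n1 * b))); [ring |].
  rewrite <- expi_plus. do 2 f_equal. zpush. ring.
Qed.

Lemma kronecker (a b : C) (m : Z) :
  (forall k : Z, Im a <> (IZR k * Im T)%R) -> (0 < Rabs (Im b) < Im T)%R ->
  Csum (lattice_term a (zc m * T + b)) =
    expi (- (zc m * a)) * (kappa T * jtheta T (a + b) / (jtheta T a * jtheta T b)).
Proof.
  intros Ha Hb. destruct (exists_floor a Ha) as [N HN].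
  apply Csum_eq, lattice_sum_shift.
  assert (Hb0 : forall k : Z, Im b <> (IZR k * Im T)%R).
  { intros k E. rewrite E, Rabs_mult, (Rabs_pos_eq (Im T)), <- abs_IZR in Hb by lra.
    assert (0 < Z.abs k < 1)%Z; [|lia]. split; apply lt_IZR; nra. }
  pose proof (jtheta_neq_0 a Ha) as Na. pose proof (jtheta_neq_0 b Hb0) as Nb.
  replace (kappa T * jtheta T (a + b) / (jtheta T a * jtheta T b))
    with (expi (zc N * b) / (1 - expi b) + off_sum T a N b);
    [now apply lattice_sum |].
  pose proof (kronecker_laurent T a N HT HN b ltac:(lra)) as K.
  rewrite (kappa_eq T a N HT HN).
  replace (full_coef T a N 0 * jtheta T a * jtheta T (a + b))
    with (jtheta T a * (full_coef T a N 0 * jtheta T (a + b))) by ring.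
  rewrite <- K. rewrite (jtheta_factor T HT b) in *.
  assert (N1 : 1 - expi b <> 0).
  { apply expi_neq_1. intros E. rewrite E, Rabs_R0 in Hb. lra. }
  assert (N2 : jtheta_red T b <> 0).
  { intros E. apply Nb. rewrite E. ring. }
  field. auto.
Qed.

(** The prefactors of eta cubed and of the three thetas combine to [e(1/4) = i], which cancels
    against [- i]. *)
Lemma theta_quotient (a b : C) :
  jtheta T a <> 0 -> jtheta T b <> 0 ->
  - (Ci * eta T ^ 3 * theta (a + b) T / (theta a T * theta b T))
  = kappa T * jtheta T (a + b) / (jtheta T a * jtheta T b).
Proof.
  intros Na Nb. rewrite (eta_cube T HT), !(theta_jtheta T HT).
  assert (E : expi (T / 8) * expi (T / 8 - (a + b) / 2 - 1 / 4)
    = Ci * (expi (T / 8 - a / 2 - 1 / 4) * expi (T / 8 - b / 2 - 1 / 4))).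
  { rewrite <- expi_quarter, <- !expi_plus. f_equal. field. }
  pose proof (expi_neq_0 (T / 8 - a / 2 - 1 / 4)) as N1.
  pose proof (expi_neq_0 (T / 8 - b / 2 - 1 / 4)) as N2.
  set (x := expi (T / 8 - a / 2 - 1 / 4)) in *.
  set (y := expi (T / 8 - b / 2 - 1 / 4)) in *.
  replace (Ci * (expi (T / 8) * kappa T) *
    (expi (T / 8 - (a + b) / 2 - 1 / 4) * jtheta T (a + b)))
    with ((Ci * Ci) * (x * y * kappa T * jtheta T (a + b))).
  2:{ transitivity (Ci * (Ci * (x * y)) * kappa T * jtheta T (a + b)); [ring |].
      rewrite <- E. ring. }
  replace (Ci * Ci) with (- (1)).
  2:{ unfold Ci, Cmult, RtoC, Copp; simpl. f_equal; ring. }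
  field. auto.
Qed.

(** The quasi-periodicity multipliers of Theta at [a + x] and at [x] have quotient [e(m a)], which
    the row shift compensates. *)
Lemma jtheta_quotient_shift (a : C) (x : C) (m : Z) :
  jtheta T a <> 0 -> jtheta T (zc m * T + x) <> 0 ->
  expi (- (zc m * a)) * (kappa T * jtheta T (a + x) / (jtheta T a * jtheta T x))
  = kappa T * jtheta T (a + (zc m * T + x)) / (jtheta T a * jtheta T (zc m * T + x)).
Proof.
  intros Na Nx. rewrite (jtheta_shift T HT m x), (jtheta_shift T HT m (a + x)).
  replace (a + x + zc m * T) with (a + (zc m * T + x)) by ring.
  replace (x + zc m * T) with (zc m * T + x) by ring.
  rewrite Cmult_plus_distr_l, expi_plus, expi_opp.
  assert (N0 : theta_coef T m <> 0) by apply expi_neq_0.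
  pose proof (expi_neq_0 (zc m * x)). pose proof (expi_neq_0 (zc m * a)).
  field. auto.
Qed.

End Kronecker.

(** * Limits along vertical lines *)

Section Limits.

Variable T a : C.
Hypothesis HT : (0 < Im T)%R.
Hypothesis Ha : forall k : Z, Im a <> (IZR k * Im T)%R.

Definition kronecker_quotient (b : C) : C :=
  kappa T * jtheta T (a + b) / (jtheta T a * jtheta T b).

(** The slope [y] carries the direction of approach and the scale 3 between [z2] and [b]; it will be
    3 or [-3]. *)
Definition vertical (x y e : R) : C := RtoC x + Ci * RtoC (y * e).

Lemma Im_vertical (x y e : R) : Im (vertical x y e) = (y * e)%R.
Proof. unfold vertical, Ci, RtoC, Cplus, Cmult, Im; simpl. ring. Qed.

Lemma vertical_strip (y : R) : y <> 0%R ->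
  at_right 0 (fun e => forall x, (0 < Rabs (Im (vertical x y e)) < Im T)%R /\
                                 jtheta T (vertical x y e) <> 0).
Proof.
  intros Hy. assert (P : (0 < Rabs y)%R) by now apply Rabs_pos_lt.
  apply (filter_imp (fun e => (0 < e < Im T / Rabs y)%R)).
  - intros e He x.
    assert (B : (0 < Rabs (Im (vertical x y e)) < Im T)%R).
    { rewrite Im_vertical, Rabs_mult, (Rabs_pos_eq e) by lra. split; [nra |].
      replace (Im T) with (Rabs y * (Im T / Rabs y))%R by (field; lra).
      apply Rmult_lt_compat_l; lra. }
    split; auto. apply jtheta_neq_0; auto. intros k E.
    rewrite E, Rabs_mult, (Rabs_pos_eq (Im T)), <- abs_IZR in B by lra.
    assert (0 < Z.abs k < 1)%Z; [|lia]. split; apply lt_IZR; nra.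
  - apply at_right_lt. now apply Rdiv_lt_0_compat.
Qed.

Lemma tends_to_numerator (x y : R) :
  tends_to (at_right 0) (fun e => kappa T * jtheta T (a + vertical x y e))
    (kappa T * jtheta T (a + RtoC x)).
Proof.
  apply (tends_to_mult (at_right 0) (fun _ => kappa T)).
  { apply (tends_to_const (at_right 0)). }
  apply (tends_to_ext (at_right 0) (fun e => jtheta T (a + RtoC x + Ci * RtoC (y * e)))).
  { apply filter_forall. intros e. f_equal. unfold vertical. ring. }
  apply laurent_tends_to. now apply theta_coef_fast.
Qed.

Lemma jtheta_real_neq_0 (x : R) : (forall k : Z, x <> IZR k) -> jtheta T (RtoC x) <> 0.
Proof.
  intros Hx. rewrite jtheta_factor by exact HT.
  apply Cmult_neq_0; [|now apply jtheta_red_real_neq_0].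
  apply Cminus_eq_contra. intros E. symmetry in E.
  destruct (expi_real_eq_1 x E) as [k Hk]. now apply (Hx k).
Qed.

Lemma kronecker_quotient_regular (x y : R) : (forall k : Z, x <> IZR k) ->
  tends_to (at_right 0) (fun e => kronecker_quotient (vertical x y e))
    (kronecker_quotient (RtoC x)).
Proof.
  intros Hx. unfold kronecker_quotient, Cdiv.
  apply (tends_to_mult (at_right 0) (fun e => kappa T * jtheta T (a + vertical x y e))
    (fun e => / (jtheta T a * jtheta T (vertical x y e)))).
  { apply tends_to_numerator. }
  apply (tends_to_inv (at_right 0)).
  { apply Cmult_neq_0; [now apply jtheta_neq_0 | now apply jtheta_real_neq_0]. }
  apply (tends_to_mult (at_right 0) (fun _ => jtheta T a)).
  { apply (tends_to_const (at_right 0)). }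
  apply laurent_tends_to. now apply theta_coef_fast.
Qed.

(** Here [1 - e(b) = 1 - exp (- 2 PI y e)] carries the pole and contributes [1 / (2 PI y)]. The
    remaining factor tends to kappa Theta(a) / (Theta(a) D(1)) = 1 because kappa is D(1), so the
    limit does not depend on [a]. *)
Lemma kronecker_quotient_pole (k : Z) (y : R) : y <> 0%R ->
  tends_to (at_right 0) (fun e => RtoC e * kronecker_quotient (vertical (IZR k) y e))
    (/ RtoC (2 * PI * y)).
Proof.
  intros Hy.
  pose proof (jtheta_neq_0 T HT a Ha) as Na.
  pose proof (kappa_neq_0 T HT) as Nk.
  assert (Er : jtheta_red T (RtoC (IZR k)) = kappa T).
  { unfold jtheta_red, kappa. replace (RtoC (IZR k)) with (0 + zc k) by (unfold zc; ring).
    apply laurent_periodic. }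
  apply (tends_to_ext (at_right 0) (fun e =>
    (kappa T * jtheta T (a + vertical (IZR k) y e)) *
    / (jtheta T a * jtheta_red T (vertical (IZR k) y e)) *
    (RtoC e / RtoC (1 - exp (- (2 * PI * y * e)))))).
  { eapply filter_imp; [|apply (vertical_strip y Hy)].
    intros e He. destruct (He (IZR k)) as [_ N].
    unfold kronecker_quotient. rewrite (jtheta_factor T HT (vertical (IZR k) y e)) in N |- *.
    assert (E : expi (vertical (IZR k) y e) = RtoC (exp (- (2 * PI * y * e)))).
    { unfold vertical. rewrite expi_plus. fold (zc k). rewrite expi_zc.
      replace (Ci * RtoC (y * e)) with (0%R, (y * e)%R)
        by (unfold Ci, RtoC, Cmult; simpl; f_equal; ring).
      rewrite expi_pair, Rmult_0_r, cos_0, sin_0.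
      replace (2 * PI * (y * e))%R with (2 * PI * y * e)%R by ring.
      unfold RtoC, Cmult; simpl. f_equal; ring. }
    rewrite E in N |- *. rewrite RtoC_minus.
    assert (N1 : 1 - RtoC (exp (- (2 * PI * y * e))) <> 0)
      by (intros Z; apply N; rewrite Z; ring).
    assert (N2 : jtheta_red T (vertical (IZR k) y e) <> 0)
      by (intros Z; apply N; rewrite Z; ring).
    field. auto. }
  replace (/ RtoC (2 * PI * y)) with
    ((kappa T * jtheta T (a + RtoC (IZR k))) *
     / (jtheta T a * jtheta_red T (RtoC (IZR k))) * / RtoC (2 * PI * y)).
  - apply (tends_to_mult (at_right 0)
      (fun e => (kappa T * jtheta T (a + vertical (IZR k) y e)) *
        / (jtheta T a * jtheta_red T (vertical (IZR k) y e)))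
      (fun e => RtoC e / RtoC (1 - exp (- (2 * PI * y * e))))).
    + apply (tends_to_mult (at_right 0)); [apply tends_to_numerator |].
      apply (tends_to_inv (at_right 0)).
      { rewrite Er. now apply Cmult_neq_0. }
      apply (tends_to_mult (at_right 0) (fun _ => jtheta T a)).
      { apply (tends_to_const (at_right 0)). }
      apply laurent_tends_to. now apply theta_psum_fast.
    + apply tends_to_exp_quotient. pose proof PI_RGT_0.
      apply Rmult_integral_contrapositive_currified; [lra | exact Hy].
  - rewrite Er. fold (zc k).
    replace (jtheta T (a + zc k)) with (jtheta T a) by (symmetry; apply laurent_periodic).
    assert (RtoC (2 * PI * y) <> 0).
    { apply RtoC_neq_0. pose proof PI_RGT_0.
      apply Rmult_integral_contrapositive_currified; [lra | exact Hy]. }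
    field. auto.
Qed.

End Limits.

(** * Specialization to [f2] *)

Lemma Im_scal3 (z : C) : Im (3 * z) = (3 * Im z)%R.
Proof. apply im_scal_l. Qed.

Lemma f2_lattice_sum (z1 z2 tau : C) : (0 < Im tau)%R ->
  f2 z1 z2 tau = Csum (lattice_term (3 * tau) (3 * z1) (3 * z2)).
Proof.
  intros Ht. unfold f2. f_equal. apply functional_extensionality.
  intros [n1 n2]. unfold lattice_term. cbn [fst snd]. cbv zeta.
  rewrite !Im_scal3, !epow_expi.
  replace (3 * Im z1 / (3 * Im tau))%R with (Im z1 / Im tau)%R by (field; lra).
  replace (3 * Im z2 / (3 * Im tau))%R with (Im z2 / Im tau)%R by (field; lra).
  set (c := RtoC (chi2 _ _)).
  replace (zc n1 * zc n2 * (3 * tau) + zc n2 * (3 * z1) + zc n1 * (3 * z2))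
    with (RtoC (3 * IZR n1 * IZR n2) * tau + RtoC (3 * IZR n2) * z1 + RtoC (3 * IZR n1) * z2)
    by (unfold zc; rewrite !RtoC_mult; ring).
  rewrite !expi_plus. ring.
Qed.

Theorem proposition5p3 (tau z1 z2 : C)
  (htau : (0 < Im tau)%R)
  (hy1 : ~ exists m : Z, Im z1 = (IZR m * Im tau)%R)
  (hy2 : exists m : Z, Im z2 = (IZR m * Im tau)%R) :
  ((exists k : Z, (Re z2 - Re tau * Im z2 / Im tau)%R = (IZR k / 3)%R) ->
     filterlim
       (fun eps : R =>
          RtoC eps * (f2 z1 (z2 + Ci * RtoC eps) tau
                      - f2 z1 (z2 - Ci * RtoC eps) tau))
       (at_right 0)
       (locally (RtoC (1 / (3 * PI)) * epow z1 (- (3 * Im z2 / Im tau))))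
     /\
     filterlim
       (fun eps : R => RtoC eps * f2 z1 (z2 + Ci * RtoC eps) tau)
       (at_right 0)
       (locally (RtoC (1 / (6 * PI)) * epow z1 (- (3 * Im z2 / Im tau)))))
  /\
  (~ (exists k : Z, (Re z2 - Re tau * Im z2 / Im tau)%R = (IZR k / 3)%R) ->
     filterlim
       (fun eps : R =>
          f2 z1 (z2 + Ci * RtoC eps) tau - f2 z1 (z2 - Ci * RtoC eps) tau)
       (at_right 0)
       (locally (RtoC 0))
     /\
     filterlim
       (fun eps : R => f2 z1 (z2 + Ci * RtoC eps) tau)
       (at_right 0)
       (locally
          (- (Ci * eta (3 * tau) ^ 3 * theta (3 * (z1 + z2)) (3 * tau)
              / (theta (3 * z1) (3 * tau) * theta (3 * z2) (3 * tau)))))).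
Proof.
  destruct hy2 as [m Hm].
  set (T := 3 * tau). set (a := 3 * z1).
  set (x := (3 * (Re z2 - Re tau * Im z2 / Im tau))%R).
  assert (HT : (0 < Im T)%R) by (unfold T; rewrite Im_scal3; lra).
  assert (Ha : forall k : Z, Im a <> (IZR k * Im T)%R).
  { intros k E. apply hy1. exists k. unfold a, T in E. rewrite !Im_scal3 in E. lra. }
  assert (Eb : 3 * z2 = zc m * T + RtoC x).
  { unfold x, T. rewrite Hm. destruct tau as [u v], z2 as [x2 y2]. simpl in *. subst y2.
    unfold zc, RtoC, Cplus, Cmult; simpl. f_equal; field; lra. }
  assert (Ev : forall s e, 3 * (z2 + RtoC s * (Ci * RtoC e)) = zc m * T + vertical x (3 * s) e).
  { intros s e. rewrite Cmult_plus_distr_l, Eb. unfold vertical. rewrite !RtoC_mult. ring. }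
  set (E0 := expi (- (zc m * a))).
  assert (EE : epow z1 (- (3 * Im z2 / Im tau)) = E0).
  { rewrite epow_expi, Hm. unfold E0, a. f_equal.
    replace (- (3 * (IZR m * Im tau) / Im tau))%R with (- (3 * IZR m))%R by (field; lra).
    rewrite RtoC_opp, RtoC_mult. unfold zc. ring. }
  (* The sign [s] treats both directions of approach at once. The equality holds only for small
     [e > 0], where the point stays strictly between lattice lines. *)
  assert (Hf : forall s, s <> 0%R -> at_right 0 (fun e =>
    E0 * kronecker_quotient T a (vertical x (3 * s) e)
    = f2 z1 (z2 + RtoC s * (Ci * RtoC e)) tau)).
  { intros s Hs. eapply filter_imp; [|apply (vertical_strip T HT (3 * s)%R); lra].
    intros e He. destruct (He x) as [B _].
    rewrite f2_lattice_sum, Ev by exact htau. symmetry. now apply kronecker. }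
  assert (Hp : at_right 0 (fun e => E0 * kronecker_quotient T a (vertical x 3 e)
    = f2 z1 (z2 + Ci * RtoC e) tau)).
  { generalize (Hf 1%R ltac:(lra)). apply filter_imp. intros e.
    rewrite Rmult_1_r. now replace (1 * (Ci * RtoC e)) with (Ci * RtoC e) by ring. }
  assert (Hn : at_right 0 (fun e => E0 * kronecker_quotient T a (vertical x (-3) e)
    = f2 z1 (z2 - Ci * RtoC e) tau)).
  { generalize (Hf (-1)%R ltac:(lra)). apply filter_imp. intros e.
    replace (3 * -1)%R with (-3)%R by ring.
    replace (z2 + RtoC (-1) * (Ci * RtoC e)) with (z2 - Ci * RtoC e); auto.
    change (RtoC (-1)) with (RtoC (- (1))). rewrite RtoC_opp. ring. }
  pose proof PI_RGT_0 as HPI.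
  split.
  - intros [k Hk]. assert (Ex : x = IZR k) by (unfold x; rewrite Hk; field).
    rewrite Ex in Hp, Hn. rewrite EE.
    pose proof (kronecker_quotient_pole T a HT Ha k 3 ltac:(lra)) as Lp.
    pose proof (kronecker_quotient_pole T a HT Ha k (-3) ltac:(lra)) as Ln.
    assert (L6 : tends_to (at_right 0)
      (fun eps => RtoC eps * f2 z1 (z2 + Ci * RtoC eps) tau) (RtoC (1 / (6 * PI)) * E0)).
    { replace (RtoC (1 / (6 * PI)) * E0) with (E0 * / RtoC (2 * PI * 3)).
      2:{ rewrite <- RtoC_inv by lra. replace (1 / (6 * PI))%R with (/ (2 * PI * 3))%R
            by (field; lra). ring. }
      eapply (tends_to_ext (at_right 0)); [|apply (tends_to_mult (at_right 0) (fun _ => E0));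
        [apply (tends_to_const (at_right 0)) | exact Lp]].
      revert Hp. apply filter_imp. intros e <-. ring. }
    assert (L6' : tends_to (at_right 0)
      (fun eps => RtoC eps * f2 z1 (z2 - Ci * RtoC eps) tau) (- RtoC (1 / (6 * PI)) * E0)).
    { replace (- RtoC (1 / (6 * PI)) * E0) with (E0 * / RtoC (2 * PI * -3)).
      2:{ rewrite <- RtoC_inv by lra. rewrite <- RtoC_opp.
          replace (- (1 / (6 * PI)))%R with (/ (2 * PI * -3))%R by (field; lra). ring. }
      eapply (tends_to_ext (at_right 0)); [|apply (tends_to_mult (at_right 0) (fun _ => E0));
        [apply (tends_to_const (at_right 0)) | exact Ln]].
      revert Hn. apply filter_imp. intros e <-. ring. }
    split; apply (tends_to_filterlim (at_right 0)); auto.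
    (* The residue has opposite signs from above and below, so the difference doubles it:
       [1/(3 pi) = 1/(6 pi) + 1/(6 pi)]. *)
    replace (RtoC (1 / (3 * PI)) * E0)
      with (RtoC (1 / (6 * PI)) * E0 + - (1) * (- RtoC (1 / (6 * PI)) * E0)).
    2:{ replace (1 / (3 * PI))%R with (1 / (6 * PI) + 1 / (6 * PI))%R by (field; lra).
        rewrite RtoC_plus. ring. }
    eapply (tends_to_ext (at_right 0)); [|apply (tends_to_plus (at_right 0)); [exact L6 |
      apply (tends_to_mult (at_right 0) (fun _ => - (1)));
        [apply (tends_to_const (at_right 0)) | exact L6']]].
    apply filter_forall. intros e. simpl. ring.
  - intros Hk.
    assert (Hx : forall k : Z, x <> IZR k).
    { intros k E. apply Hk. exists k. unfold x in E. lra. }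
    assert (Nb : jtheta T (zc m * T + RtoC x) <> 0).
    { pose proof (jtheta_real_neq_0 T HT x Hx) as N. intros E. apply N.
      rewrite (jtheta_shift T HT m).
      replace (RtoC x + zc m * T) with (zc m * T + RtoC x) by ring. rewrite E. ring. }
    pose proof (jtheta_neq_0 T HT a Ha) as Na.
    (* Away from the pole the limit is independent of the slope [y], so the difference of the two
       approaches tends to zero. *)
    assert (L : forall y, tends_to (at_right 0)
      (fun e => E0 * kronecker_quotient T a (vertical x y e))
      (E0 * kronecker_quotient T a (RtoC x))).
    { intros y. apply (tends_to_mult (at_right 0) (fun _ => E0)).
      - apply (tends_to_const (at_right 0)).
      - now apply kronecker_quotient_regular. }
    pose proof (tends_to_ext (at_right 0) _ _ _ Hp (L 3%R)) as Lp.
    pose proof (tends_to_ext (at_right 0) _ _ _ Hn (L (-3)%R)) as Ln.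
    split; apply (tends_to_filterlim (at_right 0)).
    + set (l := E0 * _) in Lp, Ln.
      replace (RtoC 0) with (l + - (1) * l) by ring.
      eapply (tends_to_ext (at_right 0)); [|apply (tends_to_plus (at_right 0)); [exact Lp |
        apply (tends_to_mult (at_right 0) (fun _ => - (1)));
          [apply (tends_to_const (at_right 0)) | exact Ln]]].
      apply filter_forall. intros e. simpl. ring.
    + replace (3 * (z1 + z2)) with (a + 3 * z2) by (unfold a; ring).
      rewrite Eb, theta_quotient by auto.
      rewrite <- jtheta_quotient_shift by auto. exact Lp.
Qed.
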